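(* Let $\Sigma_1\leftarrow\Sigma_2\leftarrow\cdots$ be a projective system of finite-dimensional simplices with affine projections $p_{n+1,n}:\Sigma_{n+1}\to\Sigma_n$ such that each $p_{n+1,n}$ ($n\ge 1$) is injective on the vertex set $\mathrm{Ex}(\Sigma_{n+1})$. Let $\Sigma_\infty=\varprojlim(\Sigma_n,p_{n,m})$, let $\rho_k$ be a metric on $\mathrm{Ex}(\Sigma_k)$ for some $k\ge 1$, and let $\{\rho_n\}_{n\ge k}$ be the corresponding internal metrics. Suppose that the family $\{\Sigma_n\}_{n\ge k}$ (equivalently, the family of vertex sets $\{\mathrm{Ex}(\Sigma_n)\}_{n\ge k}$) is uniformly compact in the internal metric. Then: (1) the projective limit is standard, i.e. every extreme point of $\Sigma_\infty$ is standard; (2) $\Sigma_\infty$ is a Bauer simplex, i.e. its Choquet boundary $\mathrm{Ex}(\Sigma_\infty)$ is closed in $\Sigma_\infty$; (3) the internal topology on $\Sigma_\infty$ coincides with the weak topology; (4) the set of extreme points of $\Sigma_\infty$ coincides with the set of limits of regular sequences. In particular, for a graded graph (Bratteli diagram) $\Gamma$, equivalently a Markov compactum, if the vertex levels $\Gamma_n=\mathrm{Ex}(\Sigma_n)$ are uniformly compact in the internal metric, then $\Gamma$ is standard, i.e. all ergodic central measures on its path space are standard, and (2)--(4) hold for $\Sigma_\infty=\mathrm{Inv}(\Gamma)$, the simplex of central measures.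
   Context: Projective limit. Each $\Sigma_n$ is a finite-dimensional simplex with vertex set $\mathrm{Ex}(\Sigma_n)$; for $n>m$, $p_{n,m}=p_{m+1,m}\circ\cdots\circ p_{n,n-1}$. A point $x_\infty\in\Sigma_\infty$ is identified with the sequence $\{x_n\}$ of its projections $x_n\in\Sigma_n$, with $p_{n+1,n}(x_{n+1})=x_n$. The weak topology on $\Sigma_\infty$ is the projective limit topology (from the usual topologies of the $\Sigma_n$). The Choquet boundary is the set $\mathrm{Ex}(\Sigma_\infty)$ of extreme points. Kantorovich extension. Given a metric $\rho$ on the vertex set $\{e_i\}$ of a finite-dimensional simplex $\Sigma$, its extension to $\Sigma$ is $$\bar\rho\Big(\sum_i c_ie_i,\sum_j d_je_j\Big)=\min\Big\{\sum_{i,j}\psi_{ij}\rho(e_i,e_j):\ \psi_{ij}\ge 0,\ \sum_j\psi_{ij}=c_i,\ \sum_i\psi_{ij}=d_j\Big\},$$ where $c_i,d_j\ge0$, $\sum c_i=\sum d_j=1$. Internal metrics. Extend $\rho_k$ from $\mathrm{Ex}(\Sigma_k)$ to $\Sigma_k$ by the Kantorovich extension (still denoted $\rho_k$). Inductively, for $n\ge k$, given the metric $\rho_n$ on $\Sigma_n$, put $\rho_{n+1}(e,f)=\rho_n(p_{n+1,n}e,p_{n+1,n}f)$ for $e,f\in\mathrm{Ex}(\Sigma_{n+1})$ and extend $\rho_{n+1}$ to all of $\Sigma_{n+1}$ by the Kantorovich extension. One has the monotonicity $\rho_n(p_{n+1,n}x,p_{n+1,n}y)\le\rho_{n+1}(x,y)$,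 and the $\rho_n$ are bounded by the diameter of $\rho_k$. The internal metric on $\Sigma_\infty$ is $\rho_\infty(x_\infty,y_\infty)=\lim_{n\to\infty}\rho_n(x_n,y_n)$, and the internal topology is the topology it defines. Uniform compactness. A family of sets $A_n\subset\Sigma_n$ ($n\ge k$) is uniformly compact in the internal metric if for every $\varepsilon>0$ there is $N$ such that for every $n\ge k$ the set $A_n$ has an $\varepsilon$-net with respect to $\rho_n$ consisting of at most $N$ points. Standardness. An extreme point $x_\infty\in\mathrm{Ex}(\Sigma_\infty)$ with projections $x_n$ is standard if $\lim_{n\to\infty}\rho_n(x_n,\mathrm{Ex}(\Sigma_n))=0$. The projective limit is standard if all its extreme points are standard. Regular sequences. A sequence of vertices $v_n\in\mathrm{Ex}(\Sigma_n)$ is regular if there is a standard extreme point $x_\infty$ whose projections $x_n$ satisfy $\rho_n(x_n,v_n)\to0$; this $x_\infty$ is called the limit of the sequence. Graph case. $\Gamma$ is an infinite, locally finite, $\mathbb N$-graded graph with finite levels $\Gamma_n$, $\Gamma_0=\{\emptyset\}$, edges only between consecutive levels, every vertex having at least one successor and every vertex of level $n\ge1$ having at least one predecessor; distinct vertices of the same level $n\ge2$ have distinct sets of predecessors. Let $\dim\gamma$ be the number of paths from $\emptyset$ to $\gamma$. $\Sigma_n$ is the simplex of probability measures on $\Gamma_n$, with vertices $\Gamma_n$, and $p_{n,n-1}$ sends a vertex $\gamma_n$ to $\sum_{\gamma_{n-1}}\lambda_{\gamma_{n-1}}^{\gamma_n}\delta_{\gamma_{n-1}}$, the sum being over the predecessors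 $\gamma_{n-1}\in\Gamma_{n-1}$ of $\gamma_n$, with $\lambda_{\gamma_{n-1}}^{\gamma_n}=\dim\gamma_{n-1}/\dim\gamma_n$. A Borel probability measure on the space of infinite paths starting at $\emptyset$ is central if for every vertex $\gamma$ all finite paths from $\emptyset$ to $\gamma$ have equal measure of the corresponding cylinder sets; $\mathrm{Inv}(\Gamma)$ is the set of central measures, identified with $\varprojlim\Sigma_n$ by sending $\mu$ to the sequence of distributions $\mu_n$ of the level-$n$ vertex of the path. Ergodic central measures are the extreme points of $\mathrm{Inv}(\Gamma)$; an ergodic central measure is standard if it is a standard extreme point. The language of Markov compacta (trajectory spaces with state sets $X_n=\Gamma_n$ and admissible transitions given by the edges) is equivalent. *)

(* Defs.v *)
From HB Require Import structures.
From mathcomp Require Import all_boot all_order all_algebra.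
From mathcomp Require Import all_classical all_reals all_analysis.

Set Implicit Arguments.
Unset Strict Implicit.
Unset Printing Implicit Defensive.
Import Order.TTheory GRing.Theory Num.Theory.
Import numFieldNormedType.Exports.
Local Open Scope classical_set_scope.
Local Open Scope ring_scope.
Local Open Scope convex_scope.

Record simplex (R : realType) (V : finType) := Simplex {
  coord :> V -> R;
  coord_ge0 : forall v, 0 <= coord v;
  coord_sum1 : \sum_v coord v = 1 }.

Section SimplexTheory.
Variables (R : realType) (V : finType).
Implicit Types x y z : simplex R V.

Lemma simplexP x y : coord x =1 coord y -> x = y.
Proof.
case: x y => [f f0 f1] [g g0 g1] /= /funext fg; subst g.
by congr Simplex; exact: Prop_irrelevance.
Qed.

HB.instance Definition _ := gen_eqMixin (simplex R V).
HB.instance Definition _ := gen_choiceMixin (simplex R V).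

(* The usual topology, induced from R^V. *)
HB.instance Definition _ := Topological.copy (simplex R V)
  (initial_topology
     (fun x : simplex R V => (coord x : prod_topology (fun _ : V => R)))).

Lemma vertex_subproof1 (v w : V) : 0 <= (w == v)%:R :> R.
Proof. by []. Qed.

Lemma vertex_subproof2 (v : V) : \sum_w (w == v)%:R = 1 :> R.
Proof.
by rewrite (bigD1 v) //= eqxx big1 ?addr0 // => w /negbTE ->.
Qed.

Definition vertex (v : V) : simplex R V :=
  Simplex (vertex_subproof1 v) (vertex_subproof2 v).

Lemma conv_subproof1 (t : {i01 R}) x y v :
  0 <= t%:num * x v + (1 - t%:num) * y v.
Proof. by rewrite addr_ge0 // mulr_ge0 ?coord_ge0 // subr_ge0. Qed.

Lemma conv_subproof2 (t : {i01 R}) x y :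
  \sum_v (t%:num * x v + (1 - t%:num) * y v) = 1.
Proof.
by rewrite big_split /= -!mulr_sumr !coord_sum1 !mulr1 addrC subrK.
Qed.

Definition simplex_conv (t : {i01 R}) x y : simplex R V :=
  Simplex (conv_subproof1 t x y) (conv_subproof2 t x y).

Lemma simplex_conv1 x y : simplex_conv 1%:i01 x y = x.
Proof. by apply: simplexP => v /=; rewrite subrr mul0r addr0 mul1r. Qed.

Lemma simplex_convmm t x : simplex_conv t x x = x.
Proof. by apply: simplexP => v /=; rewrite -mulrDl addrC subrK mul1r. Qed.

Lemma simplex_convC t x y :
  simplex_conv t x y = simplex_conv (1 - t%:inum)%:i01 y x.
Proof. by apply: simplexP => v /=; rewrite subKr addrC. Qed.

Lemma simplex_convA : convex_quasi_associative simplex_conv.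
Proof.
move=> p q r s x y z prs spq; apply: simplexP => v /=.
have spq' : 1 - s%:num = (1 - p%:num) * (1 - q%:num) by exact: spq.
rewrite !mulrDr !mulrA prs spq' -addrA; congr (_ + (_ + _)).
- by rewrite (mulrC (r%:num)).
- by rewrite -(ConvexQuasiAssoc.pq_sr prs spq') prs.
- by rewrite prs.
Qed.

HB.instance Definition _ := isConvexSpace.Build R (simplex R V)
  simplex_conv1 simplex_convmm simplex_convC simplex_convA.

End SimplexTheory.

Arguments vertex {R V} v.

Definition extreme_point (R : realType) (T : convType R) (x : T) : Prop :=
  forall (y z : T) (t : {i01 R}), 0 < t%:num < 1 ->
    x = y <| t |> z -> y = x /\ z = x.

(* The systems of the theory start at level 1: [vert n] is the vertex set of
   the (n+1)-st simplex and [proj n] is its projection p_{n+2,n+1}. *)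
Record proj_system (R : realType) := ProjSystem {
  vert : nat -> finType;
  vert_gt0 : forall n, (0 < #|vert n|)%N;
  proj : forall n, simplex R (vert n.+1) -> simplex R (vert n);
  proj_affine : forall n (t : {i01 R}) x y,
    @proj n (x <| t |> y) = proj x <| t |> proj y }.

Definition vertex_injective (R : realType) (S : proj_system R) : Prop :=
  forall n, injective (fun v : vert S n.+1 => proj (vertex v)).

Record projlim (R : realType) (S : proj_system R) := ProjLim {
  pt :> forall n, simplex R (vert S n);
  pt_compat : forall n, proj (pt n.+1) = pt n }.

Section ProjLimTheory.
Variables (R : realType) (S : proj_system R).
Implicit Types x y z : projlim S.

Lemma projlimP x y : (forall n, x n = y n) -> x = y.
Proof.
case: x y => [f fP] [g gP] /= fg.
have {}fg : f = g by exact: functional_extensionality_dep.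
by subst g; congr ProjLim; exact: Prop_irrelevance.
Qed.

HB.instance Definition _ := gen_eqMixin (projlim S).
HB.instance Definition _ := gen_choiceMixin (projlim S).

(* The weak topology: that of the projective limit. *)
HB.instance Definition _ := Topological.copy (projlim S)
  (initial_topology (fun x : projlim S =>
     (pt x : prod_topology (fun n => simplex R (vert S n))))).

Lemma projlim_conv_subproof (t : {i01 R}) x y n :
  proj (x n.+1 <| t |> y n.+1) = x n <| t |> y n.
Proof. by rewrite proj_affine !pt_compat. Qed.

Definition projlim_conv (t : {i01 R}) x y : projlim S :=
  ProjLim (projlim_conv_subproof t x y).

Lemma projlim_conv1 x y : projlim_conv 1%:i01 x y = x.
Proof. by apply: projlimP => n; exact: conv1. Qed.

Lemma projlim_convmm t x : projlim_conv t x x = x.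
Proof. by apply: projlimP => n; exact: convmm. Qed.

Lemma projlim_convC t x y :
  projlim_conv t x y = projlim_conv (1 - t%:inum)%:i01 y x.
Proof. by apply: projlimP => n; exact: convC. Qed.

Lemma projlim_convA : convex_quasi_associative projlim_conv.
Proof.
by move=> p q r s x y z prs spq; apply: projlimP => n; exact: convA.
Qed.

HB.instance Definition _ := isConvexSpace.Build R (projlim S)
  projlim_conv1 projlim_convmm projlim_convC projlim_convA.

End ProjLimTheory.

Definition is_metric (R : realType) (T : Type) (d : T -> T -> R) : Prop :=
  [/\ forall x y, 0 <= d x y,
      forall x y, d x y = 0 <-> x = y,
      forall x y, d x y = d y x
    & forall x y z, d x z <= d x y + d y z].

Definition metric_open (R : realType) (T : Type) (d : T -> T -> R)
    (U : set T) : Prop :=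
  forall x, U x -> exists2 e : R, 0 < e & forall y, d x y < e -> U y.

Definition coupling (R : realType) (V : finType) (x y : simplex R V)
    (psi : V -> V -> R) : Prop :=
  [/\ forall v w, 0 <= psi v w,
      forall v, \sum_w psi v w = x v
    & forall w, \sum_v psi v w = y w].

(* The couplings form a nonempty compact set, so this infimum is a minimum. *)
Definition kantorovich (R : realType) (V : finType) (rho : V -> V -> R)
    (x y : simplex R V) : R :=
  inf [set \sum_v \sum_w psi v w * rho v w | psi in coupling x y].

Section InternalMetric.
Variables (R : realType) (S : proj_system R) (k : nat).
Variable rho : vert S k -> vert S k -> R.

(* Index i stands for level i + k; this is the restriction of the internal
   metric to the vertices of that level. *)
Fixpoint vertex_metric (i : nat) : vert S (i + k) -> vert S (i + k) -> R :=
  match i return vert S (i + k) -> vert S (i + k) -> R with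
  | 0 => rho
  | j.+1 => fun e f : vert S (j + k).+1 =>
      kantorovich (@vertex_metric j) (proj (vertex e)) (proj (vertex f))
  end.

Definition internal_metric (i : nat) :
    simplex R (vert S (i + k)) -> simplex R (vert S (i + k)) -> R :=
  kantorovich (@vertex_metric i).

(* The sequence is nondecreasing and bounded, so the limit exists. *)
Definition limit_metric (x y : projlim S) : R :=
  limn (fun i => internal_metric (x (i + k)%N) (y (i + k)%N)).

Definition uniformly_compact (A : forall i, set (simplex R (vert S (i + k))))
    : Prop :=
  forall eps : R, 0 < eps -> exists N : nat, forall i : nat,
    exists s : seq (simplex R (vert S (i + k))),
      [/\ (size s <= N)%N,
          forall a, a \in s -> A i a
        & forall x, A i x -> exists2 a, a \in s & internal_metric x a < eps].

Definition dist_to_vertices (i : nat) (x : simplex R (vert S (i + k))) : R :=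
  inf [set internal_metric x (vertex v) | v in [set: vert S (i + k)]].

Definition standard_point (x : projlim S) : Prop :=
  extreme_point x /\
  (fun i => dist_to_vertices (x (i + k)%N)) @ \oo --> (0 : R).

(* [v] is a regular sequence and [x] is its limit. *)
Definition regular_limit (v : forall n, vert S n) (x : projlim S) : Prop :=
  standard_point x /\
  (fun i => internal_metric (x (i + k)%N) (vertex (v (i + k)%N))) @ \oo
    --> (0 : R).

End InternalMetric.

Arguments uniformly_compact {R S k} rho A.
Arguments limit_metric {R S k} rho x y.
Arguments standard_point {R S k} rho x.
Arguments regular_limit {R S k} rho v x.

(* Edges join consecutive levels by construction; since every vertex has a
   successor and levels are finite, the graph is infinite and locally finite. *)
Record graded_graph := GradedGraph {
  level : nat -> finType;
  edge : forall n, level n -> level n.+1 -> bool;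
  level0 : #|level 0| = 1%N;
  has_succ : forall n (v : level n), exists w, edge v w;
  has_pred : forall n (w : level n.+1), exists v, edge v w;
  pred_inj : forall n (w w' : level n.+2),
    [set v | edge v w]%SET = [set v | edge v w']%SET -> w = w' }.

(* Finite paths from the root to [w]: for [w] of positive level, an edge from
   some [v] to [w] together with a path from the root to [v]. *)
Fixpoint fpath (G : graded_graph) (n : nat) : level G n -> finType :=
  match n return level G n -> finType with
  | 0 => fun _ => unit
  | m.+1 => fun w => {u : {v : level G m | edge v w} & fpath (val u)}
  end.

Definition dim (G : graded_graph) (n : nat) (v : level G n) : nat := #|fpath v|.

Section GraphSystem.
Variables (R : realType) (G : graded_graph).

Lemma dimS n (w : level G n.+1) : dim w = \sum_(v | edge v w) dim v.
Proof.
rewrite /dim card_tagged sumnE big_map big_enum /=.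
rewrite (reindex_omap (val : {v : level G n | edge v w} -> _) insub) /=.
  by apply: eq_bigl => -[v vw] /=; rewrite vw insubT /= eqxx.
by move=> v vw; rewrite insubT.
Qed.

Lemma dim_gt0 n (v : level G n) : (0 < dim v)%N.
Proof.
elim: n v => [|n IH] w; first by rewrite /dim card_unit.
by have [v vw] := has_pred w; rewrite dimS (bigD1 v) //= ltn_addr.
Qed.

Definition cotransition n (v : level G n) (w : level G n.+1) : R :=
  if edge v w then (dim v)%:R / (dim w)%:R else 0.

Lemma cotransition_ge0 n (v : level G n) (w : level G n.+1) :
  0 <= cotransition v w.
Proof. by rewrite /cotransition; case: ifP. Qed.

Lemma cotransition_sum1 n (w : level G n.+1) : \sum_v cotransition v w = 1.
Proof.
rewrite -big_mkcond /= -mulr_suml -natr_sum -dimS divff //.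
by rewrite pnatr_eq0 -lt0n dim_gt0.
Qed.

Lemma graph_proj_subproof1 n (x : simplex R (level G n.+1)) v :
  0 <= \sum_w x w * cotransition v w.
Proof.
by apply: sumr_ge0 => w _; rewrite mulr_ge0 ?coord_ge0 ?cotransition_ge0.
Qed.

Lemma graph_proj_subproof2 n (x : simplex R (level G n.+1)) :
  \sum_v \sum_w x w * cotransition v w = 1.
Proof.
rewrite exchange_big /= -(coord_sum1 x); apply: eq_bigr => w _.
by rewrite -mulr_sumr cotransition_sum1 mulr1.
Qed.

Definition graph_proj n (x : simplex R (level G n.+1)) : simplex R (level G n) :=
  Simplex (graph_proj_subproof1 x) (graph_proj_subproof2 x).

Lemma graph_proj_affine n (t : {i01 R}) (x y : simplex R (level G n.+1)) :
  graph_proj (x <| t |> y) = graph_proj x <| t |> graph_proj y.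
Proof.
apply: simplexP => v /=; rewrite !mulr_sumr -big_split /=.
by apply: eq_bigr => w _; rewrite mulrDl !mulrA.
Qed.

Lemma level_gt0 n : (0 < #|level G n|)%N.
Proof.
elim: n => [|n /card_gt0P[v _]]; first by rewrite level0.
by have [w _] := has_succ v; apply/card_gt0P; exists w.
Qed.

Definition graph_system : proj_system R :=
  @ProjSystem R (fun n => level G n.+1) (fun n => level_gt0 n.+1)
    (fun n => @graph_proj n.+1) (fun n => @graph_proj_affine n.+1).

End GraphSystem.

Record ipath (G : graded_graph) := IPath {
  ipt :> forall n, level G n;
  ipt_edge : forall n, edge (ipt n) (ipt n.+1) }.

Section PathSpace.
Variable G : graded_graph.

Lemma ipath_exists : exists x : ipath G, True.
Proof.
have v0 : level G 0 by have /card_gt0P/cid[v _] := level_gt0 G 0; exact: v.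
pose s n (v : level G n) := projT1 (cid (has_succ v)).
pose x := fix x n : level G n := if n is m.+1 then s m (x m) else v0.
by exists (IPath (fun n => projT2 (cid (has_succ (x n))))).
Qed.

HB.instance Definition _ := gen_eqMixin (ipath G).
HB.instance Definition _ := gen_choiceMixin (ipath G).
HB.instance Definition _ := isPointed.Build (ipath G) (projT1 (cid ipath_exists)).

HB.instance Definition _ := Topological.copy (ipath G)
  (initial_topology (fun x : ipath G =>
     (ipt x : prod_topology (fun n => discrete_topology (level G n))))).

Definition path_space := g_sigma_algebraType (@open (ipath G)).
HB.instance Definition _ := Measurable.on path_space.

Fixpoint cylinder (n : nat) : forall v : level G n, fpath v -> set path_space :=
  match n return forall v : level G n, fpath v -> set path_space with
  | 0 => fun v _ => [set x : path_space | (x : ipath G) 0%N = v]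
  | m.+1 => fun w p => [set x : path_space | (x : ipath G) m.+1 = w]
                         `&` cylinder (tagged p)
  end.

Lemma level_measurable n (v : level G n) :
  measurable [set x : path_space | (x : ipath G) n = v].
Proof.
apply: sub_sigma_algebra.
have cev : continuous (fun x : ipath G => (x n : discrete_topology (level G n))).
  move=> x; apply: (@continuous_comp _
    (prod_topology (fun n => discrete_topology (level G n))) _
    (fun x : ipath G => ipt x) (fun f => f n)).
    exact: initial_continuous.
  exact: proj_continuous.
move/continuousP: cev => /(_ [set v]); apply.
exact: discrete_open.
Qed.

Lemma cylinder_measurable n (v : level G n) (p : fpath v) :
  measurable (cylinder p).
Proof.
elim: n v p => [|n IH] v p /=; first exact: (@level_measurable 0%N).
by apply: measurableI; [exact: (@level_measurable n.+1)|exact: IH].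
Qed.

Lemma cylinder_end n (v : level G n) (p : fpath v) (x : path_space) :
  cylinder p x -> (x : ipath G) n = v.
Proof. by case: n v p => [|n] v p //= []. Qed.

Lemma cylinder_cover n (v : level G n) (x : path_space) :
  (x : ipath G) n = v -> exists p : fpath v, cylinder p x.
Proof.
elim: n v => [|n IH] v xv /=; first by exists tt.
have xe : edge ((x : ipath G) n) v by rewrite -xv; exact: ipt_edge.
have [p px] := IH ((x : ipath G) n) erefl.
by exists (Tagged (fun u : {u : level G n | edge u v} => fpath (val u))
  (i := exist (fun u => edge u v) _ xe) p).
Qed.

Lemma cylinder_inj n (v : level G n) (p q : fpath v) (x : path_space) :
  cylinder p x -> cylinder q x -> p = q.
Proof.
elim: n v p q => [|n IH] v /=; first by case=> -[].
move=> [[u uv] p] [[w wv] q] /= [_ px] [_ qx].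
have uw : u = w by rewrite -(cylinder_end px) -(cylinder_end qx).
subst w; rewrite (bool_irrelevance uv wv) in p px *.
by rewrite (IH _ _ _ px qx).
Qed.

End PathSpace.

Definition central (R : realType) (G : graded_graph)
    (mu : probability (path_space G) R) : Prop :=
  forall n (v : level G n) (p q : fpath v), mu (cylinder p) = mu (cylinder q).

Record central_measure (R : realType) (G : graded_graph) := CentralMeasure {
  cmeasure :> probability (path_space G) R;
  cmeasure_central : central cmeasure }.

Section CentralMeasures.
Variables (R : realType) (G : graded_graph).
Implicit Types mu nu : central_measure R G.

Definition level_prob mu n (v : level G n) : R :=
  fine (mu [set x : path_space G | (x : ipath G) n = v]).

Lemma level_prob_ge0 mu n (v : level G n) : 0 <= level_prob mu v.
Proof. exact: fine_ge0. Qed.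

Lemma fine_sum_cover mu (I : finType) (F : I -> set (path_space G))
    (A : set (path_space G)) :
    (forall i, measurable (F i)) ->
    (forall i j x, F i x -> F j x -> i = j) ->
    (forall x, A x <-> exists i, F i x) ->
  fine (mu A) = \sum_i fine (mu (F i)).
Proof.
move=> mF dF AF; have -> : A = \bigcup_(i in [set` enum I]) F i.
  apply/seteqP; split => x.
    by move=> /AF[i Fix]; exists i => //=; rewrite mem_enum.
  by move=> [i _ Fix]; apply/AF; exists i.
rewrite measure_fin_bigcup //; last by move=> i j _ _ [x [Fi Fj]]; exact: dF Fi Fj.
rewrite -fsbig_seq ?enum_uniq // -sum_fine; first by rewrite big_enum.
by move=> i _; exact: fin_num_measure.
Qed.

Lemma level_prob_sum1 mu n : \sum_(v : level G n) level_prob mu v = 1.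
Proof.
rewrite -(@fine_sum_cover mu _ _ setT).
- by rewrite probability_setT.
- exact: level_measurable.
- by move=> v w x /= <-.
- by move=> x; split => // _; exists ((x : ipath G) n).
Qed.

Definition level_dist mu n : simplex R (level G n) :=
  Simplex (@level_prob_ge0 mu n) (@level_prob_sum1 mu n).

Lemma fine_cylinder mu n (v : level G n) (p : fpath v) :
  fine (mu (cylinder p)) = level_prob mu v / (dim v)%:R.
Proof.
apply: (canRL (mulfK _)); first by rewrite pnatr_eq0 -lt0n dim_gt0.
rewrite /level_prob (@fine_sum_cover mu _ (fun q : fpath v => cylinder q)
  [set x | (x : ipath G) n = v]).
- rewrite (eq_bigr (fun=> fine (mu (cylinder p)))) => [|q _].
    by rewrite sumr_const mulr_natr.
  by rewrite (cmeasure_central mu q p).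
- exact: cylinder_measurable.
- exact: cylinder_inj.
- by move=> x; split => [/cylinder_cover//|[q /cylinder_end]].
Qed.

Lemma level_dist_compat mu n :
  graph_proj (level_dist mu n.+1) = level_dist mu n.
Proof.
apply: simplexP => v /=; apply/esym.
pose B (w : level G n.+1) : set (path_space G) :=
  [set x | (x : ipath G) n = v] `&` [set x | (x : ipath G) n.+1 = w].
rewrite /level_prob (@fine_sum_cover mu _ B); first last.
- move=> x; split=> [xv|[w []]//].
  by exists ((x : ipath G) n.+1); split.
- by move=> w w' x [_ /= <-] [_ /= <-].
- by move=> w; apply: measurableI; exact: level_measurable.
apply: eq_bigr => w _; rewrite /cotransition; case: ifPn => vw; last first.
  rewrite mulr0; have -> : B w = set0; last by rewrite measure0.
  apply/seteqP; split => x // -[/= xv xw]; move: vw; rewrite -xv -xw.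
  by rewrite ipt_edge.
pose ext (p : fpath v) : fpath w :=
  Tagged (fun u : {u : level G n | edge u w} => fpath (val u))
    (i := exist (fun u => edge u w) _ vw) p.
rewrite (@fine_sum_cover mu _ (fun p : fpath v => cylinder (ext p))); first last.
- move=> x; split=> [[/= xv xw]|[p [/= xw px]]].
    by have [p px] := cylinder_cover xv; exists p; split.
  by split => //=; exact: cylinder_end px.
- by move=> p q x [_ /= px] [_ /= qx]; exact: cylinder_inj px qx.
- by move=> p; exact: cylinder_measurable.
rewrite (eq_bigr (fun=> level_prob mu w / (dim w)%:R)) => [|p _]; last first.
  exact: fine_cylinder.
rewrite sumr_const -[LHS]mulr_natr -[#|_|]/(dim v).
by rewrite -mulrA; congr (_ * _); rewrite mulrC.
Qed.

(* The identification of Inv(G) with the projective limit; level 0 carries no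
   information, since it has a single vertex. *)
Definition central_projlim mu : projlim (graph_system R G) :=
  @ProjLim R (graph_system R G) (fun n => level_dist mu n.+1)
    (fun n => level_dist_compat mu n.+1).

HB.instance Definition _ := gen_eqMixin (central_measure R G).
HB.instance Definition _ := gen_choiceMixin (central_measure R G).

(* The weak topology: that of the projective limit. *)
HB.instance Definition _ := Topological.copy (central_measure R G)
  (initial_topology central_projlim).

(* A measure is a function on all subsets of the path space, but only its
   values on measurable sets are meaningful. *)
Definition ergodic mu : Prop :=
  forall nu1 nu2 (t : R), 0 < t < 1 ->
    (forall A : set (path_space G), measurable A ->
      mu A = (t%:E * nu1 A + (1 - t)%:E * nu2 A)%E) ->
    forall A : set (path_space G), measurable A -> nu1 A = mu A /\ nu2 A = mu A.

End CentralMeasures.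

(* Main.v *)
Require Import Defs.
From HB Require Import structures.
From mathcomp Require Import all_boot all_order all_algebra.
From mathcomp Require Import all_classical all_reals all_analysis.
From mathcomp Require Import ring lra.
Set Implicit Arguments.
Unset Strict Implicit.
Unset Printing Implicit Defensive.
Import Order.TTheory GRing.Theory Num.Theory.
Import numFieldNormedType.Exports.
Local Open Scope classical_set_scope.
Local Open Scope ring_scope.
Local Open Scope convex_scope.
(* Other constants of the same names would shadow these. *)
Local Notation proj := Defs.proj.
Local Notation coord := Defs.coord.
Local Notation fpath := Defs.fpath.
Local Notation dim := Defs.dim.

(** Let [x] be a point of the projective limit, and let [f_i(x)] be the expected
    distance, for the internal metric of level [i], between two independent
    vertices with law [x_i]. Everything rests on this number. A Kantorovich
    distance is at most the cost of the independent coupling, and the metric on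
    the vertices of a level is the Kantorovich distance between their
    projections; hence [f_i(x)] decreases as [i] grows ([mean_dist_proj]).

    - If [f_i(x)] tends to 0, then [x] is extreme ([extreme_of_mean_dist]): when
      [x] is a proper mixture of [y] and [z], the mean distance between [y_i]
      and [z_i] is at most a constant times [f_i(x)], it dominates their internal
      distance, and the latter grows with [i]; so [y = z]. Moreover the distance
      of [x_i] to the vertices is at most [f_i(x)] ([vertex_close_mean_dist]),
      and conversely [f_i(x)] is at most twice the distance from [x_i] to any
      vertex ([mean_dist_le_vertex]). So [f_i(x)] tends to 0 as soon as the
      distance of [x_i] to the vertices does.

    - If [x] is extreme and the vertex sets are uniformly compact, then [f_i(x)]
      tends to 0 ([extreme_mean_dist]). Suppose that the limit is [F > 0]. At
      every level [j] some ball of radius [F / 4] has mass at least [c], where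
      [c > 0] does not depend on [j]. Let [y] be [x_j] conditioned to this ball.
      Two independent points of law [y] are within [F / 2] of each other. But
      since [x] is extreme and [c] is fixed, the projection of [y] to a given
      level [i] is close to [x_i] when [j] is large ([extreme_split_close], a
      compactness argument), so that there the mean distance is about
      [f_i(x) >= F]. On all other pairs of parts of [x] the mean distance
      decreases from [i] to [j] as well, whence [f_j(x)] is smaller than
      [f_i(x)] by a fixed multiple of [F], for every [i]: impossible.

    So, under uniform compactness, extreme points, standard points and limits of
    regular sequences are the same, and they are the points whose distance to
    the vertices tends to 0. This condition is closed for the limit metric,
    because the internal metrics of finite levels are bounded by it.

    The limit metric defines the weak topology ([internal_topology]). It
    dominates metrics of the finite levels, so its balls are small in the weak
    sense. Conversely, nets of bounded size at all levels give finite nets of the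
    projective limit ([limit_metric_codes]), and the closed balls are weakly
    closed, as the limit metric is a supremum of weakly continuous functions; a
    point has a weak neighbourhood avoiding the finitely many balls that do not
    contain it.

    For a graded graph it remains to identify ergodic central measures with
    extreme points ([ergodicP]). Measures are determined by their values on
    cylinders, and every point of the projective limit comes from a central
    measure ([central_projlim_surjective]), built by dividing the unit interval
    among the paths. *)

(** * The Kantorovich distance on a finite simplex *)

Section Kantorovich.
Variables (R : realType) (V : finType).
Implicit Types (x y z : simplex R V) (rho : V -> V -> R).

Lemma coord_le1 x v : x v <= 1.
Proof.
rewrite -(coord_sum1 x) (bigD1 v) //= lerDl.
by apply: sumr_ge0 => w _; exact: coord_ge0.
Qed.

Lemma convE t x y v :
  (x <| t |> y) v = t%:num * x v + (1 - t%:num) * y v.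
Proof. by []. Qed.

Definition cost rho (psi : V -> V -> R) := \sum_v \sum_w psi v w * rho v w.

(** The expected distance between independent points with laws [x] and [y].
    Unlike the Kantorovich distance, which it dominates, it is bilinear; and
    whereas the Kantorovich distances grow along the tower of simplices, the
    mean distances decrease. *)
Definition mean_dist rho x y := cost rho (fun v w => x v * y w).

Lemma coupling_indep x y : coupling x y (fun v w => x v * y w).
Proof.
split=> [v w|v|w]; first by rewrite mulr_ge0 ?coord_ge0.
  by rewrite -mulr_sumr coord_sum1 mulr1.
by rewrite -mulr_suml coord_sum1 mul1r.
Qed.

Lemma cost_ge0 rho psi : (forall v w, 0 <= psi v w) ->
  (forall v w, 0 <= rho v w) -> 0 <= cost rho psi.
Proof.
by move=> p0 r0; apply: sumr_ge0 => v _; apply: sumr_ge0 => w _; rewrite mulr_ge0.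
Qed.

Lemma coupling_sum1 x y psi : coupling x y psi -> \sum_v \sum_w psi v w = 1.
Proof. by case=> _ px _; rewrite (eq_bigr _ (fun v _ => px v)) coord_sum1. Qed.

Lemma cost_le_const rho x y psi D : coupling x y psi ->
  (forall v w, rho v w <= D) -> cost rho psi <= D.
Proof.
move=> c rD; rewrite -[leRHS]mul1r -(coupling_sum1 c) mulr_suml.
apply: ler_sum => v _; rewrite mulr_suml; apply: ler_sum => w _.
by rewrite ler_wpM2l//; case: c.
Qed.

Section NonnegativeCost.
Variable rho : V -> V -> R.
Hypothesis rho0 : forall v w, 0 <= rho v w.
Local Notation K := (kantorovich rho).

Let costs_has_inf x y :
  has_inf [set \sum_v \sum_w psi v w * rho v w | psi in coupling x y].
Proof.
split.
  exists (mean_dist rho x y), (fun v w => x v * y w) => //.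
  exact: coupling_indep.
by exists 0 => _ [psi [p0 _ _] <-]; exact: cost_ge0.
Qed.

Lemma kantorovich_le_cost x y psi : coupling x y psi -> K x y <= cost rho psi.
Proof.
by move=> c; apply: ge_inf; [case: (costs_has_inf x y)|exists psi].
Qed.

Lemma kantorovich_approx x y (e : R) : 0 < e ->
  exists2 psi, coupling x y psi & cost rho psi < K x y + e.
Proof.
move=> e0; have [_ [psi c <-] h] := inf_adherent e0 (costs_has_inf x y).
by exists psi.
Qed.

Lemma le_kantorovich x y D :
  (forall psi, coupling x y psi -> D <= cost rho psi) -> D <= K x y.
Proof.
move=> h; apply: lb_le_inf; first by case: (costs_has_inf x y).
by move=> _ [psi c <-]; exact: h.
Qed.

Lemma kantorovich_ge0 x y : 0 <= K x y.
Proof. by apply: le_kantorovich => psi [p0 _ _]; exact: cost_ge0. Qed.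

Lemma kantorovich_le_mean_dist x y : K x y <= mean_dist rho x y.
Proof. by apply: kantorovich_le_cost; exact: coupling_indep. Qed.

Lemma kantorovich_le_const D x y : (forall v w, rho v w <= D) -> K x y <= D.
Proof.
move=> rD; apply: le_trans (kantorovich_le_mean_dist _ _) _.
by apply: cost_le_const rD; exact: coupling_indep.
Qed.

(** All the mass must go to [v], for a column of total mass 0 vanishes. *)
Lemma coupling_vertex x v psi : coupling x (vertex v) psi ->
  forall a b, psi a b = x a * (b == v)%:R.
Proof.
move=> [p0 px pv] a b; have [->{b}|bv] := eqVneq b v.
  rewrite mulr1 -(px a) (bigD1 v)//= big1 ?addr0// => w wv.
  have /eqP := pv w; rewrite /= (negbTE wv) psumr_eq0//.
  by move/allP => /(_ a); rewrite mem_index_enum => /(_ isT)/eqP.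
have /eqP := pv b; rewrite /= (negbTE bv) mulr0 psumr_eq0//.
by move/allP => /(_ a); rewrite mem_index_enum => /(_ isT)/eqP.
Qed.

Lemma kantorovich_vertexr x v : K x (vertex v) = \sum_a x a * rho a v.
Proof.
have E psi : coupling x (vertex v) psi -> cost rho psi = \sum_a x a * rho a v.
  move=> c; apply: eq_bigr => a _; rewrite (bigD1 v)//= big1.
    by rewrite addr0 (coupling_vertex c) eqxx mulr1.
  by move=> w wv; rewrite (coupling_vertex c) (negbTE wv) mulr0 mul0r.
apply/eqP; rewrite eq_le; apply/andP; split.
  by rewrite -(E _ (coupling_indep _ _)); exact: kantorovich_le_mean_dist.
by apply: le_kantorovich => psi /E ->.
Qed.

Lemma kantorovich_vertex v w : K (vertex v) (vertex w) = rho v w.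
Proof.
rewrite kantorovich_vertexr (bigD1 v)//= eqxx mul1r big1 ?addr0// => a av.
by rewrite (negbTE av) mul0r.
Qed.

(** Moving mass only where the two distributions differ: what they have in
    common stays in place and the two remainders are coupled independently. *)
Lemma kantorovich_le_tv D x y : (forall v, rho v v = 0) -> 0 <= D ->
  (forall v w, rho v w <= D) -> K x y <= D * \sum_v `|x v - y v|.
Proof.
move=> r00 D0 rD.
pose m v := Num.min (x v) (y v).
pose s := \sum_v (x v - m v).
have mx v : 0 <= x v - m v by rewrite subr_ge0 ge_min lexx.
have my v : 0 <= y v - m v by rewrite subr_ge0 ge_min lexx orbT.
have sE : s = \sum_v (y v - m v) by rewrite /s !sumrB !coord_sum1.
have m0 v : 0 <= m v by rewrite le_min !coord_ge0.
have s0 : 0 <= s by apply: sumr_ge0.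
(* When [s = 0] the remainders vanish, and the quotient by 0 is harmless. *)
pose psi v w := (v == w)%:R * m v + (x v - m v) * (y w - m w) / s.
have dg v : \sum_w (v == w)%:R * m v = m v.
  rewrite (bigD1 v)//= eqxx mul1r big1 ?addr0// => w; rewrite eq_sym => /negbTE ->.
  by rewrite mul0r.
have c : coupling x y psi.
  split=> [v w|v|w].
  - by rewrite /psi addr_ge0 ?divr_ge0 ?mulr_ge0.
  - rewrite big_split /= dg -mulr_suml -mulr_sumr -sE.
    have [s0'|s0'] := eqVneq s 0; last by rewrite mulfK// addrC subrK.
    rewrite s0' mulr0 mul0r addr0; apply/esym/eqP; rewrite -subr_eq0.
    move/eqP: s0'; rewrite psumr_eq0// => /allP/(_ v).
    by rewrite mem_index_enum => /(_ isT).
  - rewrite big_split /= -mulr_suml -mulr_suml -/s.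
    have -> : \sum_v (v == w)%:R * m v = m w.
      rewrite (bigD1 w)//= eqxx mul1r big1 ?addr0// => v /negbTE ->.
      by rewrite mul0r.
    have [s0'|s0'] := eqVneq s 0; last by rewrite mulrAC mulfV// mul1r addrC subrK.
    rewrite s0' !mul0r addr0; apply/esym/eqP; rewrite -subr_eq0.
    move/eqP: s0'; rewrite sE psumr_eq0// => /allP/(_ w).
    by rewrite mem_index_enum => /(_ isT).
apply: le_trans (kantorovich_le_cost c) _.
have le1 v w : psi v w * rho v w <= (x v - m v) * (y w - m w) / s * D.
  rewrite /psi mulrDl; have [<-|_] := eqVneq v w.
    by rewrite r00 !mulr0 add0r !mulr_ge0 ?invr_ge0.
  by rewrite mul0r mul0r add0r ler_wpM2l// !mulr_ge0 ?invr_ge0.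
apply: (@le_trans _ _ (s * D)).
  apply: (@le_trans _ _ (\sum_v \sum_w (x v - m v) * (y w - m w) / s * D)).
    by apply: ler_sum => v _; apply: ler_sum => w _.
  rewrite (eq_bigr (fun v => (x v - m v) * (D * (s / s)))) => [|v _].
    rewrite -mulr_suml -/s ler_wpM2l//.
    have [->|s0'] := eqVneq s 0; first by rewrite invr0 !mulr0.
    by rewrite mulfV// mulr1.
  rewrite -!mulr_suml -mulr_sumr -sE; ring.
rewrite mulrC ler_wpM2l//; apply: ler_sum => v _; rewrite /m.
by case: (leP (x v) (y v)) => _; [rewrite subrr normr_ge0|rewrite ler_norm].
Qed.

End NonnegativeCost.

Section Metric.
Variable rho : V -> V -> R.
Hypothesis rhoM : is_metric rho.
Local Notation K := (kantorovich rho).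

Let rho0 v w : 0 <= rho v w. Proof. by case: rhoM. Qed.

Let rho00 v : rho v v = 0.
Proof. by case: rhoM => _ h _ _; exact/h. Qed.

Lemma kantorovichC x y : K x y = K y x.
Proof.
suff h a b : K a b <= K b a by apply/eqP; rewrite eq_le !h.
apply: le_kantorovich => // psi [p0 pb pa].
apply: le_trans (@kantorovich_le_cost _ rho0 _ _ (fun v w => psi w v) _) _.
  by split.
rewrite /cost exchange_big /=; apply: ler_sum => w _; apply: ler_sum => v _.
by case: rhoM => _ _ -> _.
Qed.

(** Gluing: the middle marginal lets a coupling of [x] and [y] be composed with
    one of [y] and [z], as transition kernels are. *)
Lemma kantorovich_triangle x y z : K x z <= K x y + K y z.
Proof.
apply/ler_addgt0Pr => e e0.
have e2 : 0 < e / 2 by rewrite divr_gt0.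
have [p [p0 px py] pK] := @kantorovich_approx _ rho0 x y _ e2.
have [q [q0 qy qz] qK] := @kantorovich_approx _ rho0 y z _ e2.
(* Where [y u = 0] both couplings give no mass to [u], and [g] is 0. *)
pose g v u w := p v u * q u w / y u.
have g0 v u w : 0 <= g v u w by rewrite divr_ge0 ?mulr_ge0 ?coord_ge0.
have gp v u : \sum_w g v u w = p v u.
  rewrite -mulr_suml -mulr_sumr qy.
  have [yu|yu] := eqVneq (y u) 0; last by rewrite mulfK.
  rewrite yu mulr0 mul0r; apply/esym/eqP.
  move/eqP: yu; rewrite -py psumr_eq0// => /allP/(_ v).
  by rewrite mem_index_enum => /(_ isT).
have gq u w : \sum_v g v u w = q u w.
  rewrite -!mulr_suml py.
  have [yu|yu] := eqVneq (y u) 0; last by rewrite mulrAC mulfV// mul1r.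
  rewrite yu !mul0r; apply/esym/eqP.
  move/eqP: yu; rewrite -qy psumr_eq0// => /allP/(_ w).
  by rewrite mem_index_enum => /(_ isT).
have c : coupling x z (fun v w => \sum_u g v u w).
  split=> [v w|v|w]; first exact: sumr_ge0.
    by rewrite exchange_big /= (eq_bigr _ (fun u _ => gp v u)).
  by rewrite exchange_big /= (eq_bigr _ (fun u _ => gq u w)).
apply: le_trans (kantorovich_le_cost rho0 c) _.
apply: (@le_trans _ _ (cost rho p + cost rho q)); last by lra.
have -> : cost rho p = \sum_v \sum_w \sum_u g v u w * rho v u.
  apply: eq_bigr => v _; rewrite exchange_big /=; apply: eq_bigr => u _.
  by rewrite -gp mulr_suml.
have -> : cost rho q = \sum_v \sum_w \sum_u g v u w * rho u w.
  rewrite /cost exchange_big /= [RHS]exchange_big /=; apply: eq_bigr => w _.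
  by rewrite exchange_big /=; apply: eq_bigr => u _; rewrite -gq mulr_suml.
rewrite -big_split /=; apply: ler_sum => v _.
rewrite -big_split /=; apply: ler_sum => w _.
rewrite -big_split /= mulr_suml; apply: ler_sum => u _.
by rewrite -mulrDr ler_wpM2l//; case: rhoM.
Qed.

Lemma kantorovich_refl x : K x x = 0.
Proof.
apply/eqP; rewrite eq_le kantorovich_ge0// andbT.
have D0 : 0 <= \sum_v \sum_w rho v w by apply: sumr_ge0 => v _; apply: sumr_ge0.
apply: le_trans (kantorovich_le_tv rho0 _ _ rho00 D0 _) _ => [v w|].
  rewrite (bigD1 v)//= (bigD1 w)//= -addrA lerDl addr_ge0//.
    by apply: sumr_ge0.
  by apply: sumr_ge0 => *; apply: sumr_ge0.
by rewrite [X in _ * X]big1 ?mulr0// => v _; rewrite subrr normr0.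
Qed.

(** A transport plan from [x] to [y] moves at least the mass [x v - y v] away
    from [v], over a distance of at least [c]. *)
Lemma coord_dist_le_kantorovich :
  exists2 c : R, 0 < c & forall x y v, c * `|x v - y v| <= K x y.
Proof.
have [c c0 cr] : exists2 c : R, 0 < c & forall v w, v != w -> c <= rho v w.
  exists (\big[Num.min/1]_(vw : V * V | vw.1 != vw.2) rho vw.1 vw.2).
    apply: lt_bigmin => // -[v w] /= vw.
    rewrite lt_neqAle rho0 andbT eq_sym; apply/eqP.
    by case: rhoM => _ h _ _; move/h/eqP; exact/negP.
  by move=> v w vw; apply: (@bigmin_le_cond _ _ _ 1 (v, w)).
exists c => // x y v.
have h (a b : simplex R V) : c * (a v - b v) <= K a b.
  apply: le_kantorovich => // psi [p0 pa pb].
  rewrite -pa -pb (bigD1 v)//= [X in _ - X](bigD1 v)//=.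
  rewrite opprD addrACA subrr add0r.
  apply: (@le_trans _ _ (\sum_(w | w != v) c * psi v w)).
    rewrite -mulr_sumr (ler_wpM2l (ltW c0))// gerBl.
    exact: sumr_ge0.
  rewrite /cost [leRHS](bigD1 v)//= [X in X + _](bigD1 v)//= rho00 mulr0 add0r.
  apply: ler_wpDr.
    by apply: sumr_ge0 => u _; apply: sumr_ge0 => w _; rewrite mulr_ge0.
  apply: ler_sum => w wv; rewrite mulrC ler_wpM2l// cr// eq_sym//.
by case: (ger0P (x v - y v)) => _; rewrite ?opprB; [|rewrite kantorovichC]; exact: h.
Qed.

Lemma kantorovich_metric : is_metric K.
Proof.
split; [exact: kantorovich_ge0| |exact: kantorovichC|exact: kantorovich_triangle].
move=> x y; split=> [Kxy|->]; last exact: kantorovich_refl.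
have [c c0 h] := coord_dist_le_kantorovich.
apply: simplexP => v; apply/eqP; rewrite -subr_eq0 -normr_le0.
by rewrite -(pmulr_rle0 _ c0) -Kxy; exact: h.
Qed.

(** Through the point [v], by the triangle inequality: points close to a vertex
    have small mean distance. *)
Lemma mean_dist_le_vertex x v : mean_dist rho x x <= 2 * K x (vertex v).
Proof.
rewrite kantorovich_vertexr//.
apply: (@le_trans _ _ (\sum_a \sum_b (x a * x b * (rho a v + rho b v)))).
  apply: ler_sum => a _; apply: ler_sum => b _.
  rewrite ler_wpM2l ?mulr_ge0 ?coord_ge0//.
  by case: rhoM => _ _ C t; rewrite [rho b v]C t.
rewrite (eq_bigr (fun a => x a * rho a v + x a * \sum_b x b * rho b v)).
  rewrite big_split /= -mulr_suml coord_sum1; lra.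
move=> a _; rewrite mulr_sumr -[in X in X + _](mulr1 (x a)) -(coord_sum1 x).
rewrite mulrAC mulr_sumr -big_split /=; apply: eq_bigr => b _; ring.
Qed.

(** The average over [v ~ x] of the distance from [x] to [v] is the mean
    distance, so some vertex is at least that close. *)
Lemma vertex_close_mean_dist x : exists v, K x (vertex v) <= mean_dist rho x x.
Proof.
apply: contrapT => /forallNP h.
have {}h v : mean_dist rho x x < K x (vertex v) by rewrite ltNge; apply/negP/h.
have E : \sum_v x v * K x (vertex v) = mean_dist rho x x.
  rewrite /mean_dist /cost [RHS]exchange_big /=; apply: eq_bigr => v _.
  rewrite kantorovich_vertexr// mulr_sumr; apply: eq_bigr => a _; ring.
have [v xv] : exists v, 0 < x v.
  apply: contrapT => /forallNP x0.
  have := coord_sum1 x; rewrite big1; first by move/eqP; rewrite eq_sym oner_eq0.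
  by move=> v _; apply/eqP; rewrite eq_le coord_ge0 andbT leNgt; apply/negP/x0.
have : \sum_w x w * (K x (vertex w) - mean_dist rho x x) = 0.
  rewrite (eq_bigr (fun w => x w * K x (vertex w) - x w * mean_dist rho x x)).
    by rewrite sumrB E -mulr_suml coord_sum1 mul1r subrr.
  by move=> w _; rewrite mulrBr.
move/eqP; rewrite psumr_eq0 => [/allP/(_ v)|w _]; last first.
  by rewrite mulr_ge0 ?coord_ge0// subr_ge0 ltW.
rewrite mem_index_enum => /(_ isT)/=; rewrite mulf_eq0 gt_eqF//= subr_eq0.
by rewrite gt_eqF.
Qed.

End Metric.
End Kantorovich.

(** * Affine maps between simplices *)

Lemma conv_split (R : realType) (U : finType) (t : {i01 R}) (x y : simplex R U) :
  t%:num < 1 -> (forall v, t%:num * y v <= x v) ->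
  exists z, x = y <| t |> z.
Proof.
move=> t1 yx.
have t1' : 0 < 1 - t%:num by rewrite subr_gt0.
pose g v := (x v - t%:num * y v) / (1 - t%:num).
have g0 v : 0 <= g v by rewrite divr_ge0 ?subr_ge0// ltW// -subr_gt0.
have g1 : \sum_v g v = 1.
  rewrite -mulr_suml sumrB -mulr_sumr !coord_sum1 mulr1 mulfV//.
  by rewrite gt_eqF.
exists (Simplex g0 g1); apply: simplexP => v.
by rewrite convE /= /g mulrCA mulfV ?gt_eqF// mulr1 addrC subrK.
Qed.

Section AffineMaps.
Variables (R : realType) (V W : finType) (f : simplex R V -> simplex R W).
Hypothesis fconv : forall (t : {i01 R}) x y, f (x <| t |> y) = f x <| t |> f y.

(** An affine map is determined by its values at the vertices: strip off the
    vertices of the support of [x] one after the other. *)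
Lemma affine_coordE x w : f x w = \sum_v x v * f (vertex v) w.
Proof.
have [n] := ubnP #|[set v | x v != 0]|%SET; elim: n x => // n IH x sx.
have [v xv] : exists v, x v != 0.
  apply: contrapT => /forallNP x0.
  have := coord_sum1 x; rewrite big1; first by move/eqP; rewrite eq_sym oner_eq0.
  by move=> v _; apply/eqP/negPn/negP.
have xv0 : 0 <= x v := coord_ge0 x v.
have [xv1|xv1] := eqVneq (x v) 1.
  have xE : x = vertex v.
    apply: simplexP => u /=; have [->//|uv] := eqVneq u v.
    have := coord_sum1 x; rewrite (bigD1 v)//= xv1 => /eqP.
    rewrite eq_sym addrC -subr_eq subrr eq_sym psumr_eq0 => [/allP/(_ u)|? _].
      by rewrite mem_index_enum uv => /(_ isT)/eqP.
    exact: coord_ge0.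
  rewrite {1}xE (bigD1 v)//= xv1 mul1r big1 ?addr0// => u uv.
  by rewrite {1}xE /= (negbTE uv) mul0r.
have xvl : x v < 1 by rewrite lt_neqAle xv1 coord_le1.
pose t := Itv01 xv0 (coord_le1 x v).
have [z xz] : exists z, x = vertex v <| t |> z.
  apply: conv_split => // u /=; have [->|_] := eqVneq u v; first by rewrite mulr1.
  by rewrite mulr0 coord_ge0.
have zE u : (1 - x v) * z u = if u == v then 0 else x u.
  have /(congr1 (fun s : simplex R V => s u)) := xz; rewrite convE /=.
  have [->|_] := eqVneq u v; first by rewrite mulr1 => h; apply: (addrI (x v)); rewrite addr0 -h.
  by rewrite mulr0 add0r.
have nz : 1 - x v != 0 by rewrite subr_eq0 eq_sym.
rewrite {1}xz fconv convE [f z w]IH /=; last first.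
  rewrite -ltnS (leq_trans _ sx)// ltnS; apply/proper_card/properP; split.
    apply/fintype.subsetP => u; rewrite !inE; apply: contraNneq => xu.
    by move/eqP: (zE u); rewrite xu if_same mulf_eq0 (negbTE nz).
  exists v; rewrite !inE//; move/eqP: (zE v); rewrite eqxx mulf_eq0 (negbTE nz)/=.
  by move/eqP->; rewrite eqxx.
rewrite [RHS](bigD1 v)//=; congr (_ + _).
rewrite mulr_sumr (bigD1 v)//= mulrA zE eqxx mul0r add0r; apply: eq_bigr => u uv.
by rewrite mulrA zE (negbTE uv).
Qed.

Variable rho : W -> W -> R.
Hypothesis rho0 : forall v w, 0 <= rho v w.

Local Notation vrho := (fun v w : V => kantorovich rho (f (vertex v)) (f (vertex w))).

(** Couplings of the images of the vertices, mixed along a coupling of [x] and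
    [y], form a coupling of the images of [x] and [y]. *)
Lemma kantorovich_affine_le x y :
  kantorovich rho (f x) (f y) <= kantorovich vrho x y.
Proof.
apply: le_kantorovich => [v w|psi [p0 px py]]; first exact: kantorovich_ge0.
have psi_c : coupling x y psi by [].
apply/ler_addgt0Pr => e e0.
have [th thP] : {th : V -> V -> W -> W -> R | forall v w,
    coupling (f (vertex v)) (f (vertex w)) (th v w) /\
    cost rho (th v w) <= vrho v w + e}.
  exists (fun v w => s2val (cid2 (kantorovich_approx rho0 (f (vertex v)) (f (vertex w)) e0))).
  move=> v w; case: cid2 => /= q q1 /ltW q2; by split.
have c : coupling (f x) (f y) (fun a b => \sum_v \sum_w psi v w * th v w a b).
  split=> [a b|a|b].
  - apply: sumr_ge0 => v _; apply: sumr_ge0 => w _; rewrite mulr_ge0//.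
    by case: (thP v w) => -[].
  - rewrite affine_coordE exchange_big /=; apply: eq_bigr => v _.
    rewrite exchange_big /= -px mulr_suml; apply: eq_bigr => w _.
    by rewrite -mulr_sumr; case: (thP v w) => -[_ -> _].
  - rewrite affine_coordE exchange_big /= (eq_bigr (fun v => \sum_w psi v w * f (vertex w) b)).
      by rewrite exchange_big /=; apply: eq_bigr => w _; rewrite -py mulr_suml.
    move=> v _; rewrite exchange_big /=; apply: eq_bigr => w _.
    by rewrite -mulr_sumr; case: (thP v w) => -[_ _ ->].
apply: le_trans (kantorovich_le_cost rho0 c) _.
have -> : cost rho (fun a b => \sum_v \sum_w psi v w * th v w a b) =
    \sum_v \sum_w psi v w * cost rho (th v w).
  rewrite /cost; under eq_bigr => a _ do under eq_bigr => b _ do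
    (rewrite mulr_suml; under eq_bigr => v _ do rewrite mulr_suml).
  under eq_bigr => a _ do rewrite exchange_big /=.
  rewrite exchange_big /=; apply: eq_bigr => v _.
  under eq_bigr => a _ do rewrite exchange_big /=.
  rewrite exchange_big /=; apply: eq_bigr => w _.
  rewrite mulr_sumr; apply: eq_bigr => a _.
  by rewrite mulr_sumr; apply: eq_bigr => b _; rewrite mulrA.
apply: (@le_trans _ _ (\sum_v \sum_w psi v w * (vrho v w + e))).
  apply: ler_sum => v _; apply: ler_sum => w _; rewrite ler_wpM2l//.
  by case: (thP v w).
rewrite -[leRHS]addr0 -[e in leRHS]mul1r -(coupling_sum1 psi_c) addr0 mulr_suml.
rewrite -big_split /=; apply: ler_sum => v _.
rewrite mulr_suml -big_split /=; apply: ler_sum => w _.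
by rewrite mulrDr.
Qed.

(** By bilinearity it is enough to compare the two sides at vertices, where the
    left one is a Kantorovich distance and the right one is the cost of the
    independent coupling. *)
Lemma mean_dist_affine_le x y : mean_dist vrho x y <= mean_dist rho (f x) (f y).
Proof.
have -> : mean_dist rho (f x) (f y) =
    \sum_v \sum_w x v * y w * mean_dist rho (f (vertex v)) (f (vertex w)).
  rewrite /mean_dist /cost.
  under eq_bigr => a _ do under eq_bigr => b _ do
    (rewrite !affine_coordE mulr_suml mulr_suml;
     under eq_bigr => v _ do rewrite mulr_sumr mulr_suml).
  under eq_bigr => a _ do rewrite exchange_big /=.
  rewrite exchange_big /=; apply: eq_bigr => v _.
  under eq_bigr => a _ do rewrite exchange_big /=.
  rewrite exchange_big /=; apply: eq_bigr => w _.
  rewrite mulr_sumr; apply: eq_bigr => a _.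
  rewrite mulr_sumr; apply: eq_bigr => b _; ring.
apply: ler_sum => v _; apply: ler_sum => w _.
by rewrite ler_wpM2l ?mulr_ge0 ?coord_ge0//; exact: kantorovich_le_mean_dist.
Qed.

End AffineMaps.

Section MeanDist.
Variables (R : realType) (V : finType) (rho : V -> V -> R).
Implicit Types x y z : simplex R V.

Lemma mean_dist_conv (t : {i01 R}) y z : let c := t%:num in
  mean_dist rho (y <| t |> z) (y <| t |> z) =
  c ^+ 2 * mean_dist rho y y + c * (1 - c) * mean_dist rho y z +
  c * (1 - c) * mean_dist rho z y + (1 - c) ^+ 2 * mean_dist rho z z.
Proof.
move=> c; rewrite /mean_dist /cost !mulr_sumr -!big_split /=; apply: eq_bigr => v _.
rewrite !mulr_sumr -!big_split /=; apply: eq_bigr => w _; rewrite -/c; ring.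
Qed.

Lemma mean_dist_le x y D : (forall v w, x v != 0 -> y w != 0 -> rho v w <= D) ->
  mean_dist rho x y <= D.
Proof.
move=> rD; rewrite -[leRHS]mul1r -(coupling_sum1 (coupling_indep x y)) mulr_suml.
apply: ler_sum => v _; rewrite mulr_suml; apply: ler_sum => w _.
have [->|xv] := eqVneq (x v) 0; first by rewrite !mul0r.
have [->|yw] := eqVneq (y w) 0; first by rewrite !(mulr0, mul0r).
by rewrite ler_wpM2l ?mulr_ge0 ?coord_ge0// rD.
Qed.

Lemma mean_dist_lipschitz D x y : (forall v w, 0 <= rho v w <= D) ->
  mean_dist rho x x <= mean_dist rho y y + 2 * D * \sum_v `|y v - x v|.
Proof.
move=> rD; set s := \sum_v _.
have -> : 2 * D * s = \sum_v \sum_w D * (x v * `|y w - x w| + `|y v - x v| * y w).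
  rewrite (eq_bigr (fun v => D * (x v * s + `|y v - x v|))) => [|v _].
    by rewrite -mulr_sumr big_split /= -mulr_suml coord_sum1 -/s; ring.
  by rewrite -mulr_sumr big_split /= -!mulr_sumr coord_sum1 mulr1.
rewrite -big_split /=; apply: ler_sum => v _.
rewrite -big_split /=; apply: ler_sum => w _.
have /andP[r0 r1] := rD v w.
have x0 := coord_ge0 x v; have y0 := coord_ge0 y w.
have h1 := ler_norm (x w - y w); rewrite distrC in h1.
have h2 := ler_norm (x v - y v); rewrite distrC in h2.
have n1 : 0 <= `|y w - x w| by [].
have n2 : 0 <= `|y v - x v| by [].
set a := `|y w - x w| in h1 n1 *; set b := `|y v - x v| in h2 n2 *.
have k : x v * x w - y v * y w <= x v * a + b * y w.
  have : x v * (x w - y w) + (x v - y v) * y w <= x v * a + b * y w.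
    by rewrite lerD// ?ler_wpM2l// ler_wpM2r.
  by apply: le_trans; rewrite le_eqVlt; apply/orP; left; apply/eqP; ring.
have kk : 0 <= x v * a + b * y w by rewrite addr_ge0// mulr_ge0.
rewrite -lerBlDl -mulrBl; apply: (@le_trans _ _ ((x v * a + b * y w) * rho v w)).
  by rewrite ler_wpM2r.
by rewrite mulrC ler_wpM2r.
Qed.

End MeanDist.

(** * The tower of internal metrics *)


Section Threads.
Variables (R : realType) (S : proj_system R).

(** A thread up to level [N] is a compatible family of points below that level;
    what lies above is arbitrary. It carries a point of level [N] together with all its
    projections. *)
Definition thread N (z : forall m, simplex R (vert S m)) :=
  forall m, (m < N)%N -> proj (z m.+1) = z m.

Lemma projlim_thread N (x : projlim S) : thread N x.
Proof. by move=> m _; exact: pt_compat. Qed.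

Lemma thread_le M N z : (M <= N)%N -> thread N z -> thread M z.
Proof. by move=> MN h m mM; apply: h; exact: leq_trans MN. Qed.

Lemma thread_through N (y : simplex R (vert S N)) :
  exists2 z, thread N z & z N = y.
Proof.
elim: N y => [|N IH] y.
  have z0 m : simplex R (vert S m).
    by have /card_gt0P/cid[v _] := vert_gt0 S m; exact: vertex v.
  by exists (dfwith z0 0 y) => //; rewrite dfwithin.
have [z zN zy] := IH (proj y).
exists (dfwith z N.+1 y); last by rewrite dfwithin.
move=> m; rewrite ltnS leq_eqVlt => /predU1P[->|mN].
  by rewrite dfwithin dfwithout// eqn_leq ltnn.
rewrite !dfwithout ?zN//; last by rewrite eqSS gtn_eqF.
by rewrite gtn_eqF// ltnS ltnW.
Qed.

Lemma thread_conv N (t : {i01 R}) (x y z : forall m, simplex R (vert S m)) :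
  thread N x -> thread N y -> thread N z -> x N = y N <| t |> z N ->
  forall m, (m <= N)%N -> x m = y m <| t |> z m.
Proof.
elim: N => [|N IH] tx ty tz xN m.
  by rewrite leqn0 => /eqP ->.
rewrite leq_eqVlt => /predU1P[->//|mN].
apply: (IH _ _ _ _ m mN); try exact: thread_le (leqnSn N) _.
by rewrite -tx// xN proj_affine ty// tz.
Qed.

Lemma projlim_eq_below (x y : projlim S) m N :
  (m <= N)%N -> x N = y N -> x m = y m.
Proof.
elim: N => [|N IH]; first by rewrite leqn0 => /eqP ->.
rewrite leq_eqVlt => /predU1P[->//|mN] xy; apply: IH => //.
by rewrite -(pt_compat x) -(pt_compat y) xy.
Qed.

End Threads.

Section Tower.
Variables (R : realType) (S : proj_system R) (k : nat).
Variable rho : vert S k -> vert S k -> R.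
Hypotheses (Sinj : vertex_injective S) (rhoM : is_metric rho).

Local Notation r i := (@vertex_metric R S k rho i).
Local Notation K i := (@internal_metric R S k rho i).
Local Notation B i := (mean_dist (@vertex_metric R S k rho i)).

Lemma vertex_metricP i : is_metric (r i).
Proof.
elim: i => [//|i IH]; have [K0 KE KC Kt] := kantorovich_metric IH.
split=> [v w|v w|v w|u v w]; [exact: K0| |exact: KC|exact: Kt].
split=> [h|->]; last by apply/(KE _ _).
by apply: Sinj; apply/KE; exact: h.
Qed.

Lemma internal_metricP i : is_metric (K i).
Proof. exact: kantorovich_metric (vertex_metricP i). Qed.

Lemma vertex_metric_ge0 i v w : 0 <= r i v w.
Proof. by case: (vertex_metricP i). Qed.

Lemma internal_metric_ge0 i x y : 0 <= K i x y.
Proof. by case: (internal_metricP i). Qed.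

Lemma internal_metricC i x y : K i x y = K i y x.
Proof. by case: (internal_metricP i). Qed.

Lemma internal_metric_triangle i x y z : K i x z <= K i x y + K i y z.
Proof. by case: (internal_metricP i). Qed.

Lemma vertex_metric_bounded :
  exists2 D : R, 0 < D & forall i v w, r i v w <= D.
Proof.
have rho0 v w : 0 <= rho v w by case: rhoM.
have s0 : 0 <= \sum_v \sum_w rho v w.
  by apply: sumr_ge0 => v _; apply: sumr_ge0.
exists (\sum_v \sum_w rho v w + 1); first exact: ltr_wpDl.
elim=> [|i IH] v w; last by apply: kantorovich_le_const => //; exact: vertex_metric_ge0.
rewrite /= (bigD1 v)//= (bigD1 w)//= -2!addrA lerDl !addr_ge0//.
  by apply: sumr_ge0.
by apply: sumr_ge0 => u _; apply: sumr_ge0.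
Qed.

Lemma internal_metric_proj i (x y : simplex R (vert S (i.+1 + k))) :
  K i (proj x) (proj y) <= K i.+1 x y.
Proof.
exact: (kantorovich_affine_le (@proj_affine _ S (i + k)) (@vertex_metric_ge0 i)).
Qed.

Lemma mean_dist_proj i (x y : simplex R (vert S (i.+1 + k))) :
  B i.+1 x y <= B i (proj x) (proj y).
Proof.
exact: (mean_dist_affine_le (@proj_affine _ S (i + k)) (@vertex_metric_ge0 i)).
Qed.

Lemma thread_internal_le i j (y z : forall m, simplex R (vert S m)) :
  thread (j + k) y -> thread (j + k) z -> (i <= j)%N ->
  K i (y (i + k)%N) (z (i + k)%N) <= K j (y (j + k)%N) (z (j + k)%N).
Proof.
elim: j => [|j IH] ty tz; first by rewrite leqn0 => /eqP ->.
rewrite leq_eqVlt => /predU1P[->//|ij].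
apply: le_trans (IH _ _ ij) _; try exact: thread_le (leqnSn _) _.
have := internal_metric_proj (y (j.+1 + k)%N) (z (j.+1 + k)%N).
by rewrite (ty (j + k)%N)// (tz (j + k)%N).
Qed.

Lemma thread_mean_le i j (y z : forall m, simplex R (vert S m)) :
  thread (j + k) y -> thread (j + k) z -> (i <= j)%N ->
  B j (y (j + k)%N) (z (j + k)%N) <= B i (y (i + k)%N) (z (i + k)%N).
Proof.
elim: j => [|j IH] ty tz; first by rewrite leqn0 => /eqP ->.
rewrite leq_eqVlt => /predU1P[->//|ij].
apply: le_trans _ (IH _ _ ij); try exact: thread_le (leqnSn _) _.
have := mean_dist_proj (y (j.+1 + k)%N) (z (j.+1 + k)%N).
by rewrite (ty (j + k)%N)// (tz (j + k)%N).
Qed.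

Section LimitMetric.
Implicit Types x y z : projlim S.

Let bound x y : exists D : R, forall i, K i (x (i + k)%N) (y (i + k)%N) <= D.
Proof.
have [D _ rD] := vertex_metric_bounded; exists D => i.
by apply: kantorovich_le_const; [exact: vertex_metric_ge0|exact: rD].
Qed.

Let mono x y : nondecreasing_seq (fun i => K i (x (i + k)%N) (y (i + k)%N)).
Proof. by move=> i j ij; apply: thread_internal_le => //; exact: projlim_thread. Qed.

Let cvg x y : cvgn (fun i => K i (x (i + k)%N) (y (i + k)%N)).
Proof.
apply: nondecreasing_is_cvgn; first exact: mono.
by have [D KD] := bound x y; exists D => _ [i _ <-].
Qed.

Lemma internal_le_limit i x y : K i (x (i + k)%N) (y (i + k)%N) <= limit_metric rho x y.
Proof. exact: (nondecreasing_cvgn_le (@mono x y) (@cvg x y)). Qed.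

Lemma limit_metric_le x y c :
  (forall i, K i (x (i + k)%N) (y (i + k)%N) <= c) -> limit_metric rho x y <= c.
Proof. by move=> h; apply: limr_le; [exact: cvg|apply: nearW]. Qed.

Lemma lt_limit_metric x y c : c < limit_metric rho x y ->
  exists i, c < K i (x (i + k)%N) (y (i + k)%N).
Proof.
move=> h; apply: contrapT => /forallNP hc; move: h; apply/negP.
by rewrite -leNgt; apply: limit_metric_le => i; rewrite leNgt; apply/negP/hc.
Qed.

Lemma limit_metricC x y : limit_metric rho x y = limit_metric rho y x.
Proof. by congr (limn _); apply/funext => i; exact: internal_metricC. Qed.

(** The levels below [k] are images of level [k], where the internal metric
    separates points. *)
Lemma projlim_eq_internal x y :
  (forall i, K i (x (i + k)%N) (y (i + k)%N) <= 0) -> x = y.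
Proof.
move=> h; apply: projlimP => n.
have xy : x (n + k)%N = y (n + k)%N.
  have [_ KE _ _] := internal_metricP n.
  by apply/KE/eqP; rewrite eq_le h internal_metric_ge0.
exact: projlim_eq_below (leq_addr k n) xy.
Qed.

End LimitMetric.

(** If [x = t y + (1 - t) z], then [t (1 - t)] times the mean distance from [y]
    to [z] is at most the mean distance of [x] to itself, while the Kantorovich
    distance from [y] to [z], which is at most the mean one, grows with the
    level. *)
Lemma extreme_of_mean_dist (x : projlim S) :
  (forall e : R, 0 < e -> exists i, B i (x (i + k)%N) (x (i + k)%N) < e) ->
  extreme_point x.
Proof.
move=> h y z t /andP[t0 t1] xE.
have yz : y = z.
  apply: projlim_eq_internal => j; rewrite leNgt; apply/negP => Kyz.
  set d := K j _ _ in Kyz; set c := t%:num in t0 t1.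
  have cc : 0 < c * (1 - c) by rewrite mulr_gt0// subr_gt0.
  have [i iB] := h _ (mulr_gt0 cc Kyz).
  pose m := maxn i j.
  have Bm : B m (x (m + k)%N) (x (m + k)%N) < c * (1 - c) * d.
    apply: le_lt_trans iB; apply: thread_mean_le; try exact: projlim_thread.
    exact: leq_maxl.
  have Bd : d <= B m (y (m + k)%N) (z (m + k)%N).
    apply: le_trans (kantorovich_le_mean_dist (@vertex_metric_ge0 m) _ _).
    apply: thread_internal_le; try exact: projlim_thread.
    exact: leq_maxr.
  have B0 u v : 0 <= B m u v.
    by apply: cost_ge0 => *; rewrite ?mulr_ge0 ?coord_ge0 ?vertex_metric_ge0.
  move: Bm; apply/negP; rewrite -leNgt xE mean_dist_conv -/c.
  apply: le_trans (ler_wpM2l (ltW cc) Bd) _.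
  rewrite -addrA -addrA; apply: ler_wpDl; first by rewrite mulr_ge0// sqr_ge0.
  by rewrite lerDl addr_ge0// mulr_ge0 ?sqr_ge0 ?(ltW cc).
have xy : x = y by rewrite xE -yz; exact: convmm.
by split; rewrite ?xy ?yz.
Qed.

End Tower.

(** * Extreme points and compactness of the projective limit *)

Section InitialTopologies.

Lemma cvg_initial_topology (S : choiceType) (T : topologicalType) (f : S -> T)
    (F : set_system S) (s : initial_topology f) :
  Filter F -> f @ F --> f s -> F --> s.
Proof.
move=> FF fF A /=; rewrite nbhsE => -[_ [[B Bop <-] Bs] BA].
rewrite nbhs_filterE; apply: filterS BA _.
by apply: (fF B); exact: open_nbhs_nbhs.
Qed.

Lemma cvg_prod_topology (I : Type) (T : I -> topologicalType)
    (F : set_system (forall i, T i)) (f : prod_topology T) :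
  Filter F -> (forall i, (fun g : prod_topology T => g i) @ F --> f i) -> F --> f.
Proof.
move=> FF h; apply/cvg_sup => i.
by apply: (@cvg_initial_topology (prod_topology T) (T i) (fun g => g i)); exact: h.
Qed.

Variables (R : realType) (S : proj_system R).

Lemma cvg_projlim (F : set_system (projlim S)) (x : projlim S) : Filter F ->
  (forall n v, (fun y : projlim S => y n v) @ F --> x n v) -> F --> x.
Proof.
move=> FF h.
apply: (@cvg_initial_topology _ _ (fun x : projlim S =>
   (pt x : prod_topology (fun n => simplex R (vert S n))))).
apply: cvg_prod_topology => n.
have FnF : Filter ((fun y : projlim S => y n) @ F) by exact: fmap_filter.
have := @cvg_initial_topology (simplex R (vert S n)) _
  (fun x : simplex R (vert S n) =>
     (coord x : prod_topology (fun _ : vert S n => R)))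
  ((fun y : projlim S => y n) @ F) (x n) FnF.
by apply; apply: cvg_prod_topology => v; exact: h.
Qed.

Lemma coord_projlim_continuous n v : continuous (fun y : projlim S => y n v).
Proof.
move=> x.
apply: (@continuous_comp (projlim S) (simplex R (vert S n)) R (fun y => y n) (fun s => s v)).
  apply: (@continuous_comp _ (prod_topology (fun n => simplex R (vert S n))) _
    (fun y : projlim S => pt y) (fun f => f n)).
    exact: initial_continuous.
  exact: proj_continuous.
apply: (@continuous_comp _ (prod_topology (fun _ : vert S n => R)) _
    (fun y : simplex R (vert S n) => coord y) (fun f => f v)).
  exact: initial_continuous.
exact: proj_continuous.
Qed.

End InitialTopologies.

Section UltraLimits.
Variables (R : realType) (U : set_system nat).
Hypothesis UU : UltraFilter U.

Lemma ultra_cvg_bounded (a b : R) (u : nat -> R) :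
  (forall n, a <= u n <= b) -> exists l : R, u @ U --> l.
Proof.
move=> uab; have uU : (u @ U) `[a, b]%classic.
  by apply: nearW => n /=; rewrite in_itv /=.
have [l [_ ul]] := @segment_compact R a b (u @ U) _ uU.
exists l => A Al; have [//|nA] := in_ultra_setVsetC (u @^-1` A) UU.
by have [x [/= nAx Ax]] := ul (~` A) A nA Al.
Qed.

(** The coordinates are bounded and the conditions defining a point of the
    projective limit are finite equalities and inequalities between them. *)
Lemma ultra_limit_thread (S : proj_system R)
    (Y : nat -> forall m, simplex R (vert S m)) :
  (forall m, \near U, proj (Y U m.+1) = Y U m) ->
  exists y : projlim S, forall m v, Y j m v @[j --> U] --> y m v.
Proof.
move=> tY.
have lY m v : exists l : R, Y j m v @[j --> U] --> l.
  by apply: (@ultra_cvg_bounded 0 1) => j; rewrite coord_ge0 coord_le1.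
pose g m v := projT1 (cid (lY m v)).
have gP m v : Y j m v @[j --> U] --> g m v by rewrite /g; case: cid.
have g0 m v : 0 <= g m v.
  by apply: (cvgr_to_ge (gP m v)); apply: nearW => j; exact: coord_ge0.
have gs m (c : vert S m -> R) :
    \sum_v Y j m v * c v @[j --> U] --> \sum_v g m v * c v.
  by apply: cvg_big => [|v _]; [exact: add_continuous|apply: cvgM; [exact: gP|exact: cvg_cst]].
have g1 m : \sum_v g m v = 1.
  have := gs m (fun=> 1); under eq_fun do under eq_bigr do rewrite mulr1.
  under eq_bigr do rewrite mulr1.
  under eq_fun do rewrite coord_sum1.
  by move=> h; apply: (cvg_unique _ h (cvg_cst _)).
pose y m := Simplex (g0 m) (g1 m).
have yc m : proj (y m.+1) = y m.
  apply: simplexP => w; rewrite (affine_coordE (@proj_affine _ S m)) /=.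
  apply: (cvg_unique _ (gs m.+1 (fun v => proj (vertex v) w))).
    exact: Rhausdorff.
  apply: cvg_trans (gP m w); apply: near_eq_cvg; near=> j.
  rewrite -(affine_coordE (@proj_affine _ S m)); congr (_ _).
  by near: j; apply: filterS (tY m) => j ->.
by exists (ProjLim yc) => m v; exact: gP.
Unshelve. all: by end_near. Qed.

End UltraLimits.

Section Extremality.
Variables (R : realType) (S : proj_system R).

(** Otherwise, pass to a limit of the splittings [x N = t y N + (1 - t) z N]:
    it is a splitting of [x] whose first part differs from [x] at level [n]. *)
Lemma extreme_split_close (x : projlim S) (t : {i01 R}) n (e : R) :
  extreme_point x -> 0 < t%:num < 1 -> 0 < e ->
  exists N0, forall N y z, (N0 <= N)%N -> thread N y -> thread N z ->
    x N = y N <| t |> z N -> \sum_v `|y n v - x n v| < e.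
Proof.
move=> xext t01 e0; apply: contrapT => /forallNP h.
have {}h N0 : exists Nyz : nat * ((forall m, simplex R (vert S m)) *
                                  (forall m, simplex R (vert S m))),
    let: (N, (y, z)) := Nyz in
    [/\ (N0 <= N)%N, thread N y, thread N z, x N = y N <| t |> z N &
        e <= \sum_v `|y n v - x n v|].
  have := h N0; apply: contra_notP => /forallNP hN N y z N0N ty tz xyz.
  by rewrite ltNge; apply/negP => he; apply: (hN (N, (y, z))).
have [f fP] := choice h.
pose Y j := (f j).2.1; pose Z j := (f j).2.2.
have YZ j : [/\ (j <= (f j).1)%N, thread (f j).1 (Y j), thread (f j).1 (Z j),
    x (f j).1 = Y j (f j).1 <| t |> Z j (f j).1 &
        e <= \sum_v `|Y j n v - x n v|].
  by have := fP j; rewrite /Y /Z; case: (f j) => N [y z].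
have [U [UU UN]] := ultraFilterLemma eventually_filter.
have big m : \near U, (m <= U)%N by apply: UN; exact: nbhs_infty_ge.
have [y yP] : exists y : projlim S, forall m v, Y j m v @[j --> U] --> y m v.
  apply: ultra_limit_thread => m; apply: filterS (big m.+1) => j mj.
  by have [jN ty _ _ _] := YZ j; rewrite ty// (leq_trans mj).
have [z zP] : exists z : projlim S, forall m v, Z j m v @[j --> U] --> z m v.
  apply: ultra_limit_thread => m; apply: filterS (big m.+1) => j mj.
  by have [jN _ tz _ _] := YZ j; rewrite tz// (leq_trans mj).
have xE : x = y <| t |> z.
  apply: projlimP => m; apply: simplexP => v.
  have /cvg_unique : t%:num * Y j m v + (1 - t%:num) * Z j m v @[j --> U] -->
      t%:num * y m v + (1 - t%:num) * z m v.
    by apply: cvgD; (apply: cvgM; first exact: cvg_cst); [exact: yP|exact: zP].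
  move=> /(_ (@Rhausdorff R)) h'; apply/esym/h' => {h'}.
  apply: cvg_trans (_ : _ --> (fun=> x m v) @ U) (cvg_cst _); apply: near_eq_cvg.
  apply: filterS (big m) => j mj.
  have [jN ty tz xN _] := YZ j.
  by rewrite (thread_conv (@projlim_thread _ _ _ x) ty tz xN (leq_trans mj jN)).
have [yx _] := xext _ _ _ t01 xE.
have : e <= \sum_v `|y n v - x n v|.
  have yl : \sum_v `|Y j n v - x n v| @[j --> U] --> \sum_v `|y n v - x n v|.
    apply: cvg_big => [|v _]; first exact: add_continuous.
    by apply: cvg_norm; apply: cvgB; [exact: yP|exact: cvg_cst].
  by apply: (cvgr_to_ge yl); apply: nearW => j; case: (YZ j).
by rewrite yx big1 ?leNgt ?e0// => v _; rewrite subrr normr0.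
Qed.

End Extremality.

(** * Uniform compactness and standardness of extreme points *)

Section Counting.
Variables (R : realType) (V : finType).
Implicit Types x y : simplex R V.

(** At most [N] cells cover the whole mass, so one of them has mass at least
    [1 / N]; [N + 2] makes the bound lie strictly between 0 and 1 for every [N]. *)
Lemma heavy_cell (T : eqType) (s : seq T) (P : V -> T -> bool) x N :
  (forall v, exists2 a, a \in s & P v a) -> (size s <= N)%N ->
  exists2 a, a \in s & N.+2%:R^-1 <= \sum_(v | P v a) x v.
Proof.
move=> cov sN; apply: contrapT => h.
have {}h a : a \in s -> \sum_(v | P v a) x v <= N.+2%:R^-1.
  by move=> sa; rewrite leNgt; apply/negP => /ltW ha; apply: h; exists a.
have : 1 <= \sum_(a <- s) \sum_(v | P v a) x v.
  rewrite (exchange_big_dep predT)//= -(coord_sum1 x); apply: ler_sum => v _.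
  have [a sa Pa] := cov v.
  rewrite (big_rem a sa)/= Pa lerDl; apply: sumr_ge0 => *; exact: coord_ge0.
apply/negP; rewrite -ltNge.
apply: (@le_lt_trans _ _ (\sum_(a <- s) N.+2%:R^-1)).
  by rewrite big_seq [leRHS]big_seq; apply: ler_sum.
rewrite big_const_seq count_predT iter_addr_0 -[_ *+ _]mulr_natr mulrC.
by rewrite ltr_pdivrMr// mul1r ltr_nat ltnS (leq_trans sN).
Qed.

Variable rho : V -> V -> R.
Hypothesis rhoM : is_metric rho.

(** Collapsing each cell of a partition to one point costs at most [e]; what is
    left are two distributions on the cells. *)
Lemma kantorovich_le_cells (J : finType) (q : V -> J) (g : J -> V) D e x y :
  0 <= D -> (forall v w, rho v w <= D) -> (forall v, rho v (g (q v)) <= e) ->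
  kantorovich rho x y <= 2 * e +
    D * \sum_j `|\sum_(v | q v == j) x v - \sum_(v | q v == j) y v|.
Proof.
move=> D0 rD re.
have rho0 v w : 0 <= rho v w by case: rhoM.
have [K0 _ KC Kt] := kantorovich_metric rhoM.
pose h z w : R := \sum_v (z : simplex R V) v * (w == g (q v))%:R.
have h0 z w : 0 <= h z w by apply: sumr_ge0 => v _; rewrite mulr_ge0// coord_ge0.
have h1 z : \sum_w h z w = 1.
  rewrite exchange_big /=; apply: etrans (coord_sum1 z); apply: eq_bigr => v _.
  by rewrite -mulr_sumr vertex_subproof2 mulr1.
pose z' z := Simplex (h0 z) (h1 z).
have close z : kantorovich rho z (z' z) <= e.
  have c : coupling z (z' z) (fun v w => z v * (w == g (q v))%:R).
    split=> [v w|v|w//]; first by rewrite mulr_ge0// coord_ge0.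
    by rewrite -mulr_sumr vertex_subproof2 mulr1.
  apply: le_trans (kantorovich_le_cost rho0 c) _.
  have -> : e = \sum_v z v * e by rewrite -mulr_suml coord_sum1 mul1r.
  apply: ler_sum => v _.
  rewrite (bigD1 (g (q v)))//= eqxx mulr1 big1 ?addr0.
    by rewrite ler_wpM2l ?coord_ge0.
  by move=> w /negbTE ->; rewrite mulr0 mul0r.
have hE z w : h z w = \sum_j (w == g j)%:R * \sum_(v | q v == j) z v.
  rewrite /h (partition_big q predT)//=; apply: eq_bigr => j _.
  by rewrite mulr_sumr; apply: eq_bigr => v /eqP ->; rewrite mulrC.
have mid : kantorovich rho (z' x) (z' y) <=
    D * \sum_j `|\sum_(v | q v == j) x v - \sum_(v | q v == j) y v|.
  have r00 v : rho v v = 0 by case: rhoM => _ h' _ _; exact/h'.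
  apply: le_trans (kantorovich_le_tv rho0 _ _ r00 D0 rD) _.
  rewrite ler_wpM2l//=.
  apply: (@le_trans _ _ (\sum_w \sum_j (w == g j)%:R *
      `|\sum_(v | q v == j) x v - \sum_(v | q v == j) y v|)).
    apply: ler_sum => w _; rewrite !hE -sumrB; apply: le_trans (ler_norm_sum _ _ _) _.
    by apply: ler_sum => j _; rewrite -mulrBr normrM ger0_norm.
  rewrite exchange_big /=; apply: ler_sum => j _.
  by rewrite -mulr_suml vertex_subproof2 mul1r.
have := Kt x (z' x) y; have := Kt (z' x) (z' y) y; rewrite (KC (z' y) y).
by have := close x; have := close y; lra.
Qed.

End Counting.

Section Standardness.
Variables (R : realType) (S : proj_system R) (k : nat).
Variable rho : vert S k -> vert S k -> R.
Hypotheses (Sinj : vertex_injective S) (rhoM : is_metric rho).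

Local Notation r i := (@vertex_metric R S k rho i).
Local Notation K i := (@internal_metric R S k rho i).
Local Notation B i := (mean_dist (@vertex_metric R S k rho i)).

Lemma internal_metric_vertex i v w : K i (vertex v) (vertex w) = r i v w.
Proof. exact: kantorovich_vertex (@vertex_metric_ge0 _ _ _ _ Sinj rhoM i) _ _. Qed.

(** Mean distances [f i] of [x] to itself decrease to some [F]. If [F > 0],
    at a late level [j] a ball of radius [F / 4] carries mass at least [c], a
    constant given by uniform compactness. The part [y] of [x] in that ball has
    mean self-distance at most [F / 2] at level [j]; yet by extremality its
    projection to an early level [i] is nearly that of [x], and so has mean
    self-distance nearly [f i >= F]. Replacing [y] by its image therefore
    costs [f] about [c ^+ 2 * (F - F / 2)] between [i] and [j], which is
    impossible when [f i] is already closer to [F]. *)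
Lemma extreme_mean_dist (x : projlim S) :
  uniformly_compact rho (fun i => range (@vertex R (vert S (i + k)))) ->
  extreme_point x ->
  forall e : R, 0 < e -> exists i, B i (x (i + k)%N) (x (i + k)%N) < e.
Proof.
move=> UC xext e e0; apply: contrapT => /forallNP h.
pose f i := B i (x (i + k)%N) (x (i + k)%N).
have {}h i : e <= f i by rewrite leNgt; apply/negP/h.
have f_inf : has_inf (range f) by split; [exists (f 0), 0|exists e => _ [i _ <-]].
pose F := inf (range f).
have F0 : 0 < F.
  apply: lt_le_trans e0 _; apply: lb_le_inf; first by case: f_inf.
  by move=> _ [i _ <-].
have Ff i : F <= f i by apply: ge_inf; [case: f_inf|exists i].
have [D D0 rD] := vertex_metric_bounded Sinj rhoM.
have r0 i v w : 0 <= r i v w := vertex_metric_ge0 Sinj rhoM v w.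
have F4 : 0 < F / 4 by rewrite divr_gt0.
have [N UN] := UC _ F4.
pose c : R := N.+2%:R^-1.
have c0 : 0 < c by rewrite invr_gt0.
have c1 : c < 1 by rewrite invf_lt1 ?ltr1n.
pose t := Itv01 (ltW c0) (ltW c1).
have tc : t%:num = c by [].
(* Level [i] is chosen so late that what remains to be lost, [f i - F], is less
   than what the heavy ball will make [f] lose, about [3 / 8 * c ^+ 2 * F]. *)
have [_ [i _ <-] fi] : exists2 fi, range f fi & fi < F + c ^+ 2 * F / 8.
  by apply: inf_adherent => //; rewrite divr_gt0// mulr_gt0// exprn_gt0.
have t01 : 0 < t%:num < 1 by rewrite tc c0 c1.
(* By Lipschitz continuity this tolerance changes the mean distance at level [i]
   by at most [F / 8]. *)
have dlt : 0 < F / (16 * D) by rewrite divr_gt0// mulr_gt0.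
have [N0 split_close] := @extreme_split_close _ _ x t (i + k) _ xext t01 dlt.
pose j := (i + N0)%N.
have [s [sN _ s_net]] := UN j.
have [a sa mass] : exists2 a, a \in s &
    c <= \sum_(v | K j (vertex v) a < F / 4) x (j + k)%N v.
  apply: heavy_cell sN => v; have [//|a sa va] := s_net (vertex v).
  by exists a.
set A := fun v => K j (vertex v) a < F / 4 in mass.
set m := \sum_(v | _) _ in mass.
have m0 : 0 < m := lt_le_trans c0 mass.
pose y0 v : R := if A v then x (j + k)%N v / m else 0.
have y00 v : 0 <= y0 v by rewrite /y0; case: ifP => // _; rewrite divr_ge0 ?coord_ge0 ?ltW.
have y01 : \sum_v y0 v = 1 by rewrite -big_mkcond /= -mulr_suml mulfV// gt_eqF.
pose y' := Simplex y00 y01.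
have [z' xyz] : exists z', x (j + k)%N = y' <| t |> z'.
  apply: conv_split => // v; rewrite tc /= /y0; case: ifP => _; last first.
    by rewrite mulr0 coord_ge0.
  by rewrite mulrCA ler_piMr ?coord_ge0// ler_pdivrMr// mul1r.
have [y ty yE] := thread_through y'.
have [z tz zE] := thread_through z'.
have tx : thread (j + k) x by exact: projlim_thread.
have xj : x (j + k)%N = y (j + k)%N <| t |> z (j + k)%N by rewrite yE zE.
have ij : (i <= j)%N by exact: leq_addr.
have xi := thread_conv tx ty tz xj (leq_add ij (leqnn k)).
have ysmall : B j (y (j + k)%N) (y (j + k)%N) <= F / 2.
  have yA v : y (j + k)%N v != 0 -> A v by rewrite yE /= /y0; case: ifP; rewrite ?eqxx.
  apply: mean_dist_le => v w /yA Av /yA Aw; rewrite -internal_metric_vertex.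
  have := internal_metric_triangle Sinj rhoM (vertex v) a (vertex w).
  by rewrite (internal_metricC Sinj rhoM a); move: Av Aw; rewrite /A; lra.
have ybig : f i - F / 8 <= B i (y (i + k)%N) (y (i + k)%N).
  have sc : \sum_v `|y (i + k)%N v - x (i + k)%N v| < F / (16 * D).
    by apply: (split_close (j + k)%N y z) => //; rewrite /j addnAC leq_addl.
  have r0D v w : 0 <= r i v w <= D by rewrite r0 rD.
  have := mean_dist_lipschitz (x (i + k)%N) (y (i + k)%N) r0D.
  have : 2 * D * \sum_v `|y (i + k)%N v - x (i + k)%N v| <= 2 * D * (F / (16 * D)).
    by rewrite ler_wpM2l ?(ltW sc)// mulr_ge0// ltW.
  have -> : 2 * D * (F / (16 * D)) = F / 8 by field; rewrite gt_eqF.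
  by rewrite -/(f i); lra.
have Byz := thread_mean_le Sinj rhoM ty tz ij.
have Bzy := thread_mean_le Sinj rhoM tz ty ij.
have Bzz := thread_mean_le Sinj rhoM tz tz ij.
have fjE := mean_dist_conv (@vertex_metric R S k rho j) t (y (j + k)%N) (z (j + k)%N).
cbv zeta in fjE; rewrite -xj tc -/(f j) in fjE.
have fiE := mean_dist_conv (@vertex_metric R S k rho i) t (y (i + k)%N) (z (i + k)%N).
cbv zeta in fiE; rewrite -xi tc -/(f i) in fiE.
have cc0 : 0 <= c * (1 - c) by rewrite mulr_ge0 ?subr_ge0 ?(ltW c0) ?(ltW c1).
have : f j <= f i - c ^+ 2 * B i (y (i + k)%N) (y (i + k)%N) + c ^+ 2 * (F / 2).
  rewrite fjE fiE.
  have := ler_wpM2l (sqr_ge0 c) ysmall.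
  have := ler_wpM2l cc0 Byz; have := ler_wpM2l cc0 Bzy.
  have := ler_wpM2l (sqr_ge0 (1 - c)) Bzz.
  by lra.
have : c ^+ 2 * (f i - F / 8) <= c ^+ 2 * B i (y (i + k)%N) (y (i + k)%N).
  by rewrite ler_wpM2l// sqr_ge0.
have : c ^+ 2 * F <= c ^+ 2 * f i by rewrite ler_wpM2l// sqr_ge0.
have : 0 < c ^+ 2 * F by rewrite mulr_gt0// exprn_gt0.
have := Ff j; lra.
Qed.

(** Replace each point of a net by a vertex close to it, if there is one: this
    doubles the radius. *)
Lemma uniformly_compact_vertices :
  uniformly_compact rho (fun i => [set: simplex R (vert S (i + k))]) ->
  uniformly_compact rho (fun i => range (@vertex R (vert S (i + k)))).
Proof.
move=> UC e e0; have e2 : 0 < e / 2 by rewrite divr_gt0.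
have [N UN] := UC _ e2; exists N => i; have [s [sN _ s_net]] := UN i.
pose g (a : simplex R (vert S (i + k))) := [pick v | K i (vertex v) a < e / 2].
exists [seq vertex v | v <- pmap g s]; split.
- by rewrite size_map (leq_trans _ sN)// size_pmap count_size.
- by move=> a /mapP[v _ ->]; exists v.
- move=> _ [v _ <-]; have [//|a sa va] := s_net (vertex v).
  have [w gw] : exists w, g a = Some w.
    by rewrite /g; case: pickP => [w _|/(_ v)]; [exists w|rewrite va].
  exists (vertex w); first by rewrite map_f// mem_pmap -gw map_f.
  move: gw; rewrite /g; case: pickP => // w' w'a [<-].
  have := internal_metric_triangle Sinj rhoM (vertex v) a (vertex w').
  by rewrite (internal_metricC Sinj rhoM a); move: va w'a; lra.
Qed.

(** Up to [e / 4], a distribution is known from the masses of the cells of a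
    finite partition, and these masses need only be known up to [M^-1]: there
    are as many cases as maps from the cells to [{0, ..., M}]. *)
Lemma uniformly_compact_simplices :
  uniformly_compact rho (fun i => range (@vertex R (vert S (i + k)))) ->
  uniformly_compact rho (fun i => [set: simplex R (vert S (i + k))]).
Proof.
move=> UC e e0; have e4 : 0 < e / 4 by rewrite divr_gt0.
have [N UN] := UC _ e4.
have [D D0 rD] := vertex_metric_bounded Sinj rhoM.
(* With [N + 1] cells, rounding their masses to multiples of [M^-1] costs at most
   [D * (N + 1) / M]. *)
pose M := (Num.truncn (4 * D * N.+1%:R / e)).+1.
have M0 : 0 < M%:R :> R by [].
have DM : D * (N.+1%:R / M%:R) < e / 4.
  have : 4 * D * N.+1%:R / e < M%:R by rewrite truncnS_gt.
  rewrite ltr_pdivrMr// => h; rewrite mulrA ltr_pdivrMr//; lra.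
exists #|{ffun 'I_N.+1 -> 'I_M.+1}| => i.
have [s [sN sV s_net]] := UN i.
have /card_gt0P/cid[v0 _] := vert_gt0 S (i + k).
pose near_net v := find (fun a => K i (vertex v) a < e / 4) s.
have near_netP v : has (fun a => K i (vertex v) a < e / 4) s.
  by have [//|a sa va] := s_net (vertex v); apply/hasP; exists a.
have near_netN v : (near_net v < N.+1)%N.
  by rewrite ltnS (leq_trans _ sN)// ltnW// -has_find.
pose q v : 'I_N.+1 := Ordinal (near_netN v).
pose g (j : 'I_N.+1) := odflt v0 [pick u | vertex u == nth (vertex v0) s j].
have qg v : r i v (g (q v)) <= e / 4.
  have := nth_find (vertex v0) (near_netP v); rewrite -/(near_net v) => h.
  have [u _ uE] : range vertex (nth (vertex v0) s (near_net v)).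
    by apply: sV; rewrite mem_nth// -has_find.
  rewrite -internal_metric_vertex /g /=; case: pickP => [w /= /eqP ->|/(_ u)].
    exact: ltW.
  by rewrite uE eqxx.
pose W (x : simplex R (vert S (i + k))) (j : 'I_N.+1) := \sum_(v | q v == j) x v.
have W0 x j : 0 <= W x j by apply: sumr_ge0 => *; exact: coord_ge0.
have W1 x j : W x j <= 1.
  rewrite -(coord_sum1 x) [leRHS](bigID (fun v => q v == j))/= lerDl.
  by apply: sumr_ge0 => *; exact: coord_ge0.
pose code x : {ffun 'I_N.+1 -> 'I_M.+1} := [ffun j => inord (Num.truncn (M%:R * W x j))].
have MW0 x j : 0 <= M%:R * W x j by rewrite mulr_ge0.
have codeE x j : code x j = Num.truncn (M%:R * W x j) :> nat.
  rewrite ffunE inordK// ltnS -(ler_nat R).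
  by have /andP[h _] := truncn_itv (MW0 x j); rewrite (le_trans h)// ler_piMr.
have close x y : code x = code y -> K i x y < e.
  move=> xy.
  have Wxy j : `|W x j - W y j| <= M%:R^-1.
    have /(congr1 (@nat_of_ord _)) : code x j = code y j by rewrite xy.
    rewrite !codeE => tE.
    have /andP[xl xu] := truncn_itv (MW0 x j); have /andP[yl yu] := truncn_itv (MW0 y j).
    rewrite tE in xl xu.
    rewrite -(ler_pM2l M0) mulfV ?gt_eqF// -[M%:R in leLHS]ger0_norm// -normrM mulrBr.
    by rewrite ler_norml; move: xl xu yl yu; rewrite -natr1; lra.
  apply: le_lt_trans (kantorovich_le_cells (vertex_metricP Sinj rhoM i) x y (ltW D0) (rD i) qg) _.
  have : D * \sum_j `|W x j - W y j| <= D * (N.+1%:R / M%:R).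
    rewrite ler_wpM2l ?(ltW D0)//; apply: le_trans (ler_sum _ (fun j _ => Wxy j)) _.
    by rewrite sumr_const card_ord mulr_natl.
  by rewrite /W; move: DM; lra.
exists [seq xget (vertex v0) [set x | code x = phi] | phi <- enum {: {ffun 'I_N.+1 -> 'I_M.+1}}].
split=> [|//|x _]; first by rewrite size_map -cardE.
exists (xget (vertex v0) [set y | code y = code x]).
  by apply/mapP; exists (code x); rewrite ?mem_enum.
apply: close; apply/esym.
exact: (@xgetPex _ (vertex v0) [set y | code y = code x] (ex_intro _ x erefl)).
Qed.

End Standardness.

(** * The internal topology and the Choquet boundary *)

Section InternalTopology.
Variables (R : realType) (S : proj_system R) (k : nat).
Variable rho : vert S k -> vert S k -> R.
Hypotheses (Sinj : vertex_injective S) (rhoM : is_metric rho).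
Implicit Types x y z : projlim S.

Local Notation r i := (@vertex_metric R S k rho i).
Local Notation K i := (@internal_metric R S k rho i).
Local Notation B i := (mean_dist (@vertex_metric R S k rho i)).
Local Notation d := (limit_metric rho).
Local Notation UC := (uniformly_compact rho (fun i => [set: simplex R (vert S (i + k))])).

(** A net of bounded size at each level codes the points of the projective limit
    at that level; the limit of the codes along an ultrafilter serves for all
    levels at once. *)
Lemma limit_metric_codes (e : R) : UC -> 0 < e ->
  exists (N : nat) (code : projlim S -> 'I_N.+1),
    forall x y, code x = code y -> d x y <= e.
Proof.
move=> uc e0; have e2 : 0 < e / 2 by rewrite divr_gt0.
have [N UN] := uc _ e2; exists N.
pose s i := projT1 (cid (UN i)).
have sP i : (size (s i) <= N)%N /\
    forall x : simplex R (vert S (i + k)), exists2 a, a \in s i & K i x a < e / 2.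
  rewrite /s; case: cid => /= l [lN _ l_net]; split=> // x.
  exact: l_net.
pose c x i := find (fun a => K i (x (i + k)%N) a < e / 2) (s i).
have cP x i : has (fun a => K i (x (i + k)%N) a < e / 2) (s i).
  by have [_ /(_ (x (i + k)%N))[a sa xa]] := sP i; apply/hasP; exists a.
have cN x i : (c x i < N.+1)%N.
  by have [sN _] := sP i; rewrite ltnS (leq_trans _ sN)// ltnW// -has_find.
have [U [UU UN']] := ultraFilterLemma eventually_filter.
have lim_code x : exists j : 'I_N.+1, \near U, c x U = j.
  apply: contrapT => /forallNP h.
  have /filter_forall/filter_ex[i /(_ (Ordinal (cN x i)))/(_ erefl)//] :
    forall j : 'I_N.+1, \near U, c x U <> j.
  move=> j; have [/h//|] := in_ultra_setVsetC [set i | c x i = j] UU.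
  by apply: filterS.
exists (fun x => projT1 (cid (lim_code x))) => x y.
case: cid => /= jx jxP; case: cid => /= jy jyP jxy; subst jy.
apply: (limit_metric_le Sinj rhoM) => i.
have /filter_ex[l [[xl yl] il]] : \near U, (c x U = jx /\ c y U = jx) /\ (i <= U)%N.
  apply: filterI; first exact: filterI.
  by apply: UN'; exact: nbhs_infty_ge.
apply: le_trans (thread_internal_le Sinj rhoM _ _ il) _; try exact: projlim_thread.
have [sl _] := sP l.
have := nth_find (y (l + k)%N) (cP x l); have := nth_find (y (l + k)%N) (cP y l).
rewrite -/(c x l) -/(c y l) xl yl; set a := nth _ _ _ => ya xa.
have := internal_metric_triangle Sinj rhoM (x (l + k)%N) a (y (l + k)%N).
by rewrite (internal_metricC Sinj rhoM a); lra.
Qed.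

Lemma near_internal_metric i x (e : R) : 0 < e ->
  \forall y \near x, K i (x (i + k)%N) ((y : projlim S) (i + k)%N) < e.
Proof.
move=> e0; have [D D0 rD] := vertex_metric_bounded Sinj rhoM.
have eD : 0 < e / D by rewrite divr_gt0.
have r00 v : r i v v = 0 by case: (vertex_metricP Sinj rhoM i) => _ h _ _; exact/h.
have xx0 : \sum_v `|x (i + k)%N v - x (i + k)%N v| = 0.
  by rewrite big1// => v _; rewrite subrr normr0.
have cv : \sum_v `|x (i + k)%N v - (y : projlim S) (i + k)%N v| @[y --> x] -->
    \sum_v `|x (i + k)%N v - x (i + k)%N v|.
  have FFx : Filter (nbhs x) by exact: nbhs_filter.
  apply: (@cvg_big _ _ _ _ _ _ _ (nbhs x) _ _ _ FFx) => [|v _]; first exact: add_continuous.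
  apply: cvg_norm; apply: cvgB; first exact: cvg_cst.
  exact: coord_projlim_continuous.
rewrite xx0 in cv; move/cvgrPdist_lt/(_ _ eD): cv.
apply: (@filterS _ (nbhs x) _ _ _ _) => y /=.
rewrite sub0r normrN ger0_norm; last by apply: sumr_ge0.
rewrite ltr_pdivlMr// mulrC; apply: le_lt_trans.
exact: (kantorovich_le_tv (@vertex_metric_ge0 _ _ _ _ Sinj rhoM i) _ _ r00 (ltW D0) (rD i)).
Qed.

(** [d] is a supremum of weakly continuous functions, so that its closed balls
    are weakly closed; finitely many small ones cover the limit, and those that
    miss [x] can be avoided near [x]. *)
Lemma nbhs_limit_ball x (e : R) : UC -> 0 < e -> \forall y \near x, d x y < e.
Proof.
move=> uc e0; have e3 : 0 < e / 3 by rewrite divr_gt0.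
have [N [code codeP]] := limit_metric_codes uc e3.
have h j : nbhs x [set y | code y = j -> d x y <= 2 * (e / 3)].
  have [[c [cj xc]]|nc] := pselect (exists c, code c = j /\ e / 3 < d c x); last first.
    apply: filterS filterT => y _ /= yj; rewrite leNgt; apply/negP => xy; apply: nc.
    by exists y; split=> //; rewrite (limit_metricC Sinj rhoM); lra.
  have [i iK] := lt_limit_metric Sinj rhoM xc.
  have gap : 0 < K i (c (i + k)%N) (x (i + k)%N) - e / 3 by rewrite subr_gt0.
  apply: filterS (near_internal_metric i x gap) => y /= xy yj.
  have := codeP c y; rewrite cj yj => /(_ erefl).
  have := internal_le_limit Sinj rhoM i c y.
  have := internal_metric_triangle Sinj rhoM (c (i + k)%N) (y (i + k)%N) (x (i + k)%N).
  rewrite (internal_metricC Sinj rhoM (y _)); move: xy; lra.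
have FFx : Filter (nbhs x) by exact: nbhs_filter.
by apply: filterS (filter_forall FFx h) => y /= /(_ _ erefl) xy; lra.
Qed.

(** At the levels above [k] the internal metrics dominate the coordinates, and
    the lower levels are continuous images of these. *)
Lemma nbhs_contains_limit_ball x (U : set (projlim S)) : nbhs x U ->
  exists2 e : R, 0 < e & forall y, d x y < e -> U y.
Proof.
pose F := filter_from [set e : R | 0 < e] (fun e => [set y | d x y < e]).
have FF : Filter F.
  apply: filter_from_filter; first by exists 1 => /=.
  move=> a b a0 b0; exists (Num.min a b) => /=; first by rewrite lt_min a0 b0.
  by move=> y /=; rewrite lt_min => /andP[].
suff /[apply] : F --> x by [].
have high i v : (fun y : projlim S => y (i + k)%N v) @ F --> x (i + k)%N v.
  have [c c0 h] := coord_dist_le_kantorovich (vertex_metricP Sinj rhoM i).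
  apply/cvgrPdist_lt => e e0; exists (c * e); first by rewrite /= mulr_gt0.
  move=> y /= xy; rewrite -(ltr_pM2l c0); apply: le_lt_trans xy.
  exact: le_trans (h _ _ _) (internal_le_limit Sinj rhoM i x y).
have down m N : (m <= N)%N ->
    (forall v, (fun y : projlim S => y N v) @ F --> x N v) ->
    forall v, (fun y : projlim S => y m v) @ F --> x m v.
  elim: N => [|N IH]; first by rewrite leqn0 => /eqP ->.
  rewrite leq_eqVlt => /predU1P[->//|mN] hN; apply: IH => // v.
  have E y : y N v = \sum_w y N.+1 w * proj (vertex w) v.
    by rewrite -(affine_coordE (@proj_affine _ S N)) pt_compat.
  rewrite E; under eq_fun do rewrite E.
  apply: cvg_big => [|w _]; first exact: add_continuous.
  by apply: cvgM; [exact: hN|exact: cvg_cst].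
apply: cvg_projlim => n v.
by apply: (down n (n + k)%N) => //; rewrite leq_addr.
Qed.

Lemma internal_topology : UC ->
  forall U : set (projlim S), open U <-> metric_open d U.
Proof.
move=> uc U; split=> [oU x Ux|mU].
  by apply: nbhs_contains_limit_ball; exact: open_nbhs_nbhs.
rewrite openE => x /mU[e e0 xe]; apply: filterS xe _; exact: nbhs_limit_ball.
Qed.

Lemma dist_to_vertices_le i (x : simplex R (vert S (i + k))) v :
  dist_to_vertices rho x <= K i x (vertex v).
Proof.
apply: ge_inf; last by exists v.
by exists 0 => _ [w _ <-]; exact: internal_metric_ge0.
Qed.

Lemma dist_to_vertices_ge0 i (x : simplex R (vert S (i + k))) :
  0 <= dist_to_vertices rho x.
Proof.
have /card_gt0P/cid[v _] := vert_gt0 S (i + k).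
apply: lb_le_inf; first by exists (K i x (vertex v)), v.
by move=> _ [w _ <-]; exact: internal_metric_ge0.
Qed.

Lemma dist_to_vertices_approx i (x : simplex R (vert S (i + k))) (e : R) : 0 < e ->
  exists v, K i x (vertex v) < dist_to_vertices rho x + e.
Proof.
move=> e0; have /card_gt0P/cid[v _] := vert_gt0 S (i + k).
have [|_ [w _ <-] h] := @inf_adherent _ [set K i x (vertex v) | v in [set: vert S (i + k)]] _ e0.
  split; first by exists (K i x (vertex v)), v.
  by exists 0 => _ [w _ <-]; exact: internal_metric_ge0.
by exists w.
Qed.

Lemma dist_to_vertices_cvg0 x :
  (forall e : R, 0 < e -> exists i, B i (x (i + k)%N) (x (i + k)%N) < e) ->
  (fun i => dist_to_vertices rho (x (i + k)%N)) @ \oo --> (0 : R).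
Proof.
move=> h; apply/cvgrPdist_lt => e /h[i ie]; exists i => // j /= ij.
rewrite sub0r normrN ger0_norm ?dist_to_vertices_ge0//.
have [v xv] := vertex_close_mean_dist (vertex_metricP Sinj rhoM j) (x (j + k)%N).
apply: le_lt_trans (dist_to_vertices_le _ v) _; apply: le_lt_trans xv _.
apply: le_lt_trans ie; apply: thread_mean_le => //; exact: projlim_thread.
Qed.

(** A distribution that is nearly a vertex has a small mean distance to itself. *)
Lemma extreme_of_close_vertices x :
  (forall e : R, 0 < e -> exists i v, K i (x (i + k)%N) (vertex v) < e) ->
  extreme_point x.
Proof.
move=> h; apply: (extreme_of_mean_dist Sinj rhoM) => e e0.
have [i [v xv]] := h _ (divr_gt0 e0 (ltr0Sn R 1)); exists i.
apply: le_lt_trans (mean_dist_le_vertex (vertex_metricP Sinj rhoM i) _ v) _.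
by move: xv; rewrite /internal_metric; lra.
Qed.

Lemma extreme_standard x : UC -> extreme_point x -> standard_point rho x.
Proof.
move=> uc xext; split=> //; apply: dist_to_vertices_cvg0 => e.
by apply: extreme_mean_dist => //; exact: uniformly_compact_vertices.
Qed.

Lemma extreme_closed : UC -> closed [set x : projlim S | extreme_point x].
Proof.
move=> uc x xcl; apply: extreme_of_close_vertices => e e0.
have e3 : 0 < e / 3 by rewrite divr_gt0.
have [y [yext xy]] := xcl _ (nbhs_limit_ball x uc e3).
have [_ /cvgrPdist_lt/(_ _ e3)[i _ /(_ i (leqnn i))/=]] := extreme_standard uc yext.
rewrite sub0r normrN ger0_norm ?dist_to_vertices_ge0// => yi.
have [v yv] := dist_to_vertices_approx (y (i + k)%N) e3.
exists i, v; have := internal_metric_triangle Sinj rhoM (x (i + k)%N) (y (i + k)%N) (vertex v).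
have := internal_le_limit Sinj rhoM i x y; move: xy => /=; lra.
Qed.

(** Take at each level a vertex that is nearest to the point up to [1 / (i + 1)]. *)
Lemma standard_regular x : standard_point rho x -> exists v, regular_limit rho v x.
Proof.
move=> xstd; have [_ xcvg] := xstd.
(* A vertex is needed at every level [n], while distances live at the levels
   [i + k]: hence the transport along [i + k = n]. Below [k] any vertex does. *)
have near_vertex n : exists v : vert S n, forall i (E : (i + k)%N = n),
    K i (x (i + k)%N) (vertex (eq_rect_r (fun m => vert S m) v E)) <
      dist_to_vertices rho (x (i + k)%N) + i.+1%:R^-1.
  have [kn|nk] := leqP k n; last first.
    have /card_gt0P/cid[v _] := vert_gt0 S n; exists v => i E.
    by exfalso; move: nk; rewrite -E ltnNge leq_addl.
  have {kn} [i E] : exists i, (i + k)%N = n by exists (n - k)%N; rewrite subnK.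
  subst n; have i0 : 0 < i.+1%:R^-1 :> R by rewrite invr_gt0.
  have [v xv] := dist_to_vertices_approx (x (i + k)%N) i0; exists v => j E.
  have ji : j = i by apply/eqP; rewrite -(eqn_add2r k) E.
  by subst j; rewrite (eq_irrelevance E erefl).
exists (fun n => projT1 (cid (near_vertex n))); split=> //.
have up : (fun i => dist_to_vertices rho (x (i + k)%N) + i.+1%:R^-1) @ \oo --> (0 : R).
  by rewrite -[0]addr0; apply: cvgD => //; exact: cvg_harmonic.
apply: (squeeze_cvgr _ (cvg_cst 0) up); apply: nearW => i.
rewrite (internal_metric_ge0 Sinj rhoM)/=.
by case: cid => v /= /(_ i erefl) /ltW.
Qed.

Lemma projlim_standard : UC ->
  [/\ forall x, extreme_point x -> standard_point rho x,
      closed [set x : projlim S | extreme_point x],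
      forall U : set (projlim S), open U <-> metric_open d U
    & [set x : projlim S | extreme_point x] =
      [set x | exists v, regular_limit rho v x]].
Proof.
move=> uc; split; [by move=> x; exact: extreme_standard|exact: extreme_closed| |].
  exact: internal_topology.
apply/seteqP; split=> x /= => [xext|[v [[]]]//].
by apply: standard_regular; exact: extreme_standard.
Qed.

End InternalTopology.

(** * Cylinders in the path space of a graded graph *)

Section Cylinders.
Variable G : graded_graph.
Local Notation PS := (path_space G).

Lemma level0_eq (v w : level G 0) : v = w.
Proof.
have /eqP/fintype1P[r rE] := level0 G.
by rewrite (rE v) (rE w).
Qed.

Lemma cylinderP n (v : level G n) (p : fpath v) (x y : PS) : cylinder p x ->
  cylinder p y <-> forall m, (m <= n)%N -> (y : ipath G) m = (x : ipath G) m.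
Proof.
elim: n v p => [|n IH] v p /=.
  move=> xv; split=> [yv m|/(_ 0 (leqnn 0)) ->//].
  by rewrite leqn0 => /eqP ->; rewrite yv xv.
move=> [xv px]; split=> [[yv /(IH _ _ px) py] m|h].
  by rewrite leq_eqVlt => /predU1P[->|]; [rewrite yv xv|exact: py].
split; first by rewrite h.
by apply/(IH _ _ px) => m mn; apply: h; exact: leq_trans mn (leqnSn n).
Qed.

Lemma cylinder_of (x : PS) n : exists (v : level G n) (p : fpath v), cylinder p x.
Proof.
by exists ((x : ipath G) n); exact: cylinder_cover.
Qed.

(** A neighbourhood in a product of discrete spaces restricts finitely many
    coordinates only. *)
Lemma nbhs_cylinder (x : ipath G) (U : set (ipath G)) : nbhs x U ->
  exists n, forall y : ipath G, (forall m, (m <= n)%N -> y m = x m) -> U y.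
Proof.
pose F := filter_from [set: nat] (fun n =>
  [set y : ipath G | forall m, (m <= n)%N -> y m = x m]).
have FF : Filter F.
  apply: filter_from_filter; first by exists 0.
  move=> a b _ _; exists (maxn a b) => // y /= h.
  by split=> m mn; apply: h; rewrite leq_max mn ?orbT.
suff h : F --> x by move=> /h[n _ nU]; exists n.
apply: (@cvg_initial_topology _ _ (fun x : ipath G =>
     (ipt x : prod_topology (fun n => discrete_topology (level G n))))).
apply: (@cvg_prod_topology nat
  (fun n => discrete_topology (level G n) : topologicalType)).
move=> n A /= /nbhs_singleton Ax.
by exists n => // y /= /(_ n (leqnn n)) yn; rewrite /= yn.
Qed.

Definition cylinders : set (set PS) :=
  [set A | A = set0 \/ exists n (v : level G n) (p : fpath v), A = cylinder p].

(** Two cylinders are nested or disjoint. *)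
Lemma setI_closed_cylinders : setI_closed cylinders.
Proof.
have h n (v : level G n) (p : fpath v) m (w : level G m) (q : fpath w) :
    (n <= m)%N -> cylinders (cylinder p `&` cylinder q).
  move=> nm; have [[x [px qx]]|pq] := pselect (exists x, cylinder p x /\ cylinder q x).
    right; exists m, w, q; apply/seteqP; split=> [y []//|y qy]; split=> //.
    apply/(cylinderP _ px) => l ln; have /(cylinderP _ qx) := qy; apply.
    exact: leq_trans nm.
  by left; rewrite -subset0 => x pqx; apply: pq; exists x.
move=> A B [->|[n [v [p ->]]]]; first by rewrite set0I; left.
move=> [->|[m [w [q ->]]]]; first by rewrite setI0; left.
have [nm|/ltnW mn] := leqP n m; first exact: h.
by rewrite setIC; exact: h.
Qed.

(** There are countably many cylinders, so that every open set is a countable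
    union of some. *)
Lemma measurable_cylinders : @measurable _ PS = <<s cylinders >>.
Proof.
apply/seteqP; split; last first.
  apply: smallest_sub; first exact: sigma_algebra_measurable.
  move=> _ [->|[n [v [p ->]]]]; first exact: measurable0.
  exact: cylinder_measurable.
apply: smallest_sub; first exact: smallest_sigma_algebra.
move=> U oU.
have -> : U = \bigcup_n \bigcup_(p in [set p : {v : level G n & fpath v} |
    cylinder (tagged p) `<=` (U : set PS)]) cylinder (tagged p).
  apply/seteqP; split=> x; last by move=> [n _ [p /= pU px]]; exact: pU.
  move=> Ux; have [n nU] := nbhs_cylinder (open_nbhs_nbhs (conj oU Ux)).
  have [v [p px]] := cylinder_of x n; exists n => //.
  exists (Tagged (@fpath G n) p) => //= y /(cylinderP _ px); exact: nU.
apply: sigma_algebra_bigcup => n.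
apply: (@fin_bigcup_measurable _ (g_sigma_algebraType cylinders)).
  exact: sub_finite_set (@subsetT _ _) finite_finset.
move=> p _; apply: sub_sigma_algebra; right; by exists n, (tag p), (tagged p).
Qed.

(** Cylinders are stable under intersection and generate the Borel sets; those
    of level 0 are the whole space. *)
Lemma cylinder_measure_unique (R : realType) (m1 m2 : {measure set PS -> \bar R}) :
  (forall n (v : level G n) (p : fpath v), m1 (cylinder p) = m2 (cylinder p)) ->
  (forall n (v : level G n) (p : fpath v), (m1 (cylinder p) < +oo)%E) ->
  forall A, measurable A -> m1 A = m2 A.
Proof.
move=> m12 m1fin.
have /card_gt0P/cid[v0 _] := level_gt0 G 0.
have [p _] : exists p : fpath v0, True.
  by have := dim_gt0 v0; rewrite /dim => /card_gt0P[p _]; exists p.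
apply: (@measure_unique _ _ _ cylinders (fun=> cylinder p)).
- exact: measurable_cylinders.
- exact: setI_closed_cylinders.
- by move=> _; right; exists 0, v0, p.
- apply/seteqP; split=> // x _; exists 0 => //.
  by have [v [q]] := cylinder_of x 0; move: p; rewrite (level0_eq v0 v).
- by move=> _ [->|[n [v [q ->]]]]; rewrite ?measure0.
- by move=> _; exact: m1fin.
Qed.

End Cylinders.

(** * Central measures with prescribed level distributions *)

Section Offsets.
Variables (R : realType) (T : eqType) (f : T -> R).
Hypothesis f0 : forall u, 0 <= f u.

(** The intervals [[offset s w, offset s w + f w[], for [w] in [s], are laid one
    after the other in the order of [s]. *)
Definition offset (s : seq T) w := \sum_(u <- take (index w s) s) f u.

Lemma offset_ge0 s w : 0 <= offset s w.
Proof. exact: sumr_ge0. Qed.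

Lemma offset_cons u s w :
  offset (u :: s) w = if u == w then 0 else f u + offset s w.
Proof.
by rewrite /offset /=; case: eqVneq => _; rewrite ?take0 ?big_nil//= big_cons.
Qed.

Lemma offset_le_sum s w : w \in s -> offset s w + f w <= \sum_(u <- s) f u.
Proof.
elim: s => // u s IH; rewrite inE big_cons offset_cons eq_sym.
case: eqVneq => [->|_ /= /IH]; last by rewrite -addrA lerD2l.
by rewrite add0r lerDl => _; exact: sumr_ge0.
Qed.

Lemma offset_disjoint s w w' : (index w s < index w' s)%N ->
  offset s w + f w <= offset s w'.
Proof.
elim: s => // u s IH /=; rewrite !offset_cons.
case: eqVneq => [<-|_]; case: eqVneq => [_|_] //.
  by rewrite add0r lerDl offset_ge0.
by rewrite ltnS => /IH; rewrite -addrA lerD2l.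
Qed.

Lemma offset_cover s a : uniq s -> 0 <= a < \sum_(u <- s) f u ->
  exists2 w, w \in s & offset s w <= a < offset s w + f w.
Proof.
elim: s a => [|u s IH] a; first by rewrite big_nil => _ /andP[/le_lt_trans h /h]; rewrite ltxx.
move=> /= /andP[us s_uniq]; rewrite big_cons => /andP[a0 au].
have [lt_au|le_ua] := ltP a (f u).
  by exists u; rewrite ?mem_head// offset_cons eqxx a0 add0r.
have [|w sw wa] := IH (a - f u) s_uniq; first by rewrite subr_ge0 le_ua ltrBlDl.
exists w; first by rewrite inE sw orbT.
rewrite offset_cons; case: eqVneq => [uw|_]; first by rewrite uw sw in us.
by move: wa => /andP[]; lra.
Qed.

Lemma offset_inj s w w' a : w \in s ->
  offset s w <= a < offset s w + f w -> offset s w' <= a < offset s w' + f w' ->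
  w = w'.
Proof.
move=> sw /andP[w1 w2] /andP[w1' w2'].
have [/offset_disjoint h|/offset_disjoint h|ww'] := ltngtP (index w s) (index w' s).
- by exfalso; move: w1 w2 w1' w2' h; lra.
- by exfalso; move: w1 w2 w1' w2' h; lra.
- by rewrite -(nth_index w sw) ww' nth_index// -index_mem -ww' index_mem.
Qed.

End Offsets.

Section PathMeasure.
Variables (R : realType) (G : graded_graph) (y : projlim (graph_system R G)).
Local Notation PS := (path_space G).

(** The point of the projective limit, with the redundant level 0 restored. *)
Definition level_point n : simplex R (level G n) :=
  match n return simplex R (level G n) with
  | 0 => graph_proj (y 0%N : simplex R (level G 1))
  | m.+1 => y m
  end.

Lemma level_point_proj n : graph_proj (level_point n.+1) = level_point n.
Proof. by case: n => // n; exact: (pt_compat y n). Qed.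

(** A central measure gives equal masses to the [dim v] paths ending at [v]. *)
Definition path_mass n (v : level G n) : R := level_point n v / (dim v)%:R.

Lemma path_mass_ge0 n (v : level G n) : 0 <= path_mass v.
Proof. by rewrite divr_ge0 ?coord_ge0. Qed.

Lemma path_mass_root (v : level G 0) : path_mass v = 1.
Proof.
rewrite /path_mass /dim card_unit divr1; have := coord_sum1 (level_point 0).
rewrite (bigD1 v)// big1 => [|w /andP[_]]; last by rewrite (level0_eq w v) eqxx.
by move=> h; rewrite -[LHS]addr0.
Qed.

Definition children n (v : level G n) := [seq w <- enum (level G n.+1) | edge v w].

Lemma mem_children n (v : level G n) w : (w \in children v) = edge v w.
Proof. by rewrite mem_filter mem_enum andbT. Qed.

(** Compatibility of the projections is what makes the masses of the one-edge
    extensions of a path add up to its own. *)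
Lemma path_mass_children n (v : level G n) :
  path_mass v = \sum_(w <- children v) path_mass w.
Proof.
rewrite big_filter big_enum_cond /= {1}/path_mass -level_point_proj /=.
rewrite mulr_suml [RHS]big_mkcond; apply: eq_bigr => w _.
rewrite /cotransition; case: ifP => _; last by rewrite mulr0 mul0r.
by rewrite /path_mass; field; rewrite !pnatr_eq0 -!lt0n !dim_gt0.
Qed.

Definition child_offset n (v : level G n) w := offset (@path_mass n.+1) (children v) w.

Lemma child_offset_ge0 n (v : level G n) w : 0 <= child_offset v w.
Proof. by apply: offset_ge0; exact: path_mass_ge0. Qed.

Lemma child_offset_le n (v : level G n) w : edge v w ->
  child_offset v w + path_mass w <= path_mass v.
Proof.
move=> vw; rewrite [leRHS]path_mass_children.
by apply: (offset_le_sum (@path_mass_ge0 n.+1)); rewrite mem_children.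
Qed.

(** The child whose interval contains [a]; the default, for [a] outside the
    interval of [v], only ensures that an edge is followed. *)
Definition child_at n (v : level G n) (a : R) : level G n.+1 :=
  if [pick w | edge v w & child_offset v w <= a < child_offset v w + path_mass w]
    is Some w then w else projT1 (cid (has_succ v)).

Lemma child_at_edge n (v : level G n) a : edge v (child_at v a).
Proof. by rewrite /child_at; case: pickP => [w /andP[]//|_]; case: cid. Qed.

Lemma child_atP n (v : level G n) a : 0 <= a < path_mass v ->
  child_offset v (child_at v a) <= a <
    child_offset v (child_at v a) + path_mass (child_at v a).
Proof.
rewrite path_mass_children => a_v.
have [|w wv wa] := offset_cover _ a_v.
  by rewrite filter_uniq// enum_uniq.
rewrite /child_at; case: pickP => [u /andP[]//|/(_ w)].
by rewrite -mem_children wv wa.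
Qed.

Lemma child_at_eq n (v : level G n) w a : edge v w ->
  child_offset v w <= a < child_offset v w + path_mass w -> child_at v a = w.
Proof.
move=> vw wa; rewrite /child_at; case: pickP => [u /andP[vu ua]|/(_ w)].
  by apply: (offset_inj (@path_mass_ge0 n.+1)) ua wa; rewrite mem_children.
by rewrite vw wa.
Qed.

(** Nested intervals: [[0, 1[] is divided among the paths, each path receiving
    an interval of length its mass. The state of [s] at level [n] consists of
    the vertex and the left endpoint of the interval of level [n] around [s]. *)
Fixpoint state (s : R) (n : nat) : level G n * R :=
  match n return level G n * R with
  | 0 => (projT1 (cid (card_gt0P (level_gt0 G 0))), 0)
  | m.+1 => let va := state s m in
            let w := child_at va.1 (s - va.2) in
            (w, va.2 + child_offset va.1 w)
  end.

Definition path_at (s : R) : ipath G :=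
  IPath (fun n => child_at_edge (state s n).1 (s - (state s n).2)).

Fixpoint left_end n : forall v : level G n, fpath v -> R :=
  match n return forall v : level G n, fpath v -> R with
  | 0 => fun _ _ => 0
  | m.+1 => fun w p => left_end (tagged p) + child_offset (val (tag p)) w
  end.

Lemma cylinder_left_end n (v : level G n) (p : fpath v) s :
  cylinder p (path_at s : PS) -> (state s n).2 = left_end p.
Proof.
elim: n v p => [//|n IH] w [[u uw] p] /= [sw ps].
have su : (state s n).1 = u := cylinder_end ps.
have {}sw : child_at (state s n).1 (s - (state s n).2) = w := sw.
by rewrite sw su (IH _ _ ps).
Qed.

Lemma left_end_bounds n (v : level G n) (p : fpath v) :
  0 <= left_end p /\ left_end p + path_mass v <= 1.
Proof.
elim: n v p => [|n IH] w; first by move=> _ /=; rewrite path_mass_root add0r.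
move=> [[u uw] p] /=; have [l0 l1] := IH _ p; split.
  by rewrite addr_ge0// child_offset_ge0.
by apply: le_trans l1; rewrite -addrA lerD2l child_offset_le.
Qed.

Lemma state_interval s n : 0 <= s < 1 ->
  (state s n).2 <= s < (state s n).2 + path_mass (state s n).1.
Proof.
move=> s01; elim: n => [|n]; first by rewrite /= path_mass_root add0r.
move=> /andP[s1 s2] /=.
have /child_atP/andP[] : 0 <= s - (state s n).2 < path_mass (state s n).1.
  by rewrite subr_ge0 s1 ltrBlDl.
by set o := child_offset _ _; set l := path_mass _; move=> *; apply/andP; split; lra.
Qed.

(** The intervals of a given level are disjoint and cover [[0, 1[], and each is
    divided among the extensions of its path. *)
Lemma cylinder_path_at n (v : level G n) (p : fpath v) s : 0 <= s < 1 ->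
  cylinder p (path_at s : PS) <-> left_end p <= s < left_end p + path_mass v.
Proof.
move=> s01; split=> [ps|].
  have := state_interval n s01; rewrite (cylinder_left_end ps).
  by have -> : (state s n).1 = v := cylinder_end ps.
elim: n v p => [|n IH] w; first by move=> p _; exact: level0_eq.
move=> [[u uw] p] /= /andP[s1 s2].
have co_ge0 := child_offset_ge0 u w; have co_le := child_offset_le uw.
have ps : cylinder p (path_at s : PS) by apply: IH; apply/andP; split; lra.
split=> //.
have su : (state s n).1 = u := cylinder_end ps.
have : child_at (state s n).1 (s - (state s n).2) = w.
  rewrite su (cylinder_left_end ps); apply: child_at_eq => //.
  by apply/andP; split; lra.
by [].
Qed.

(** Outside [[0, 1[] a constant value keeps the map measurable on all of [R]. *)
Definition unit_path (s : measurableTypeR R) : PS :=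
  if (s : R) \in `[0, 1[ then path_at s else path_at 0.

Lemma unit_path_measurable : measurable_fun setT unit_path.
Proof.
apply: (measurability (@cylinders G) (measurable_cylinders G)).
move=> _ [_ [->|[n [v [p ->]]]] <-]; first by rewrite preimage_set0 setI0.
rewrite setTI.
have -> : unit_path @^-1` cylinder p =
    (`[0, 1[%classic `&` `[left_end p, left_end p + path_mass v[%classic) `|`
    (~` `[0, 1[%classic `&` [set _ | cylinder p (path_at 0 : PS)]).
  apply/seteqP; split=> s /=; rewrite /unit_path !in_itv /=; case: ifPn => s01.
  - by move/(cylinder_path_at p s01) => h; left.
  - by move=> h; right; split=> //; exact/negP.
  - by move=> [[_ h]|[]//]; exact/cylinder_path_at.
  - by move=> [[]|[]]//; rewrite (negbTE s01).
apply: measurableU; first by apply: measurableI; exact: measurable_itv.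
apply: measurableI; first by apply: measurableC; exact: measurable_itv.
have [h|h] := pselect (cylinder p (path_at 0 : PS)).
  by rewrite (_ : [set _ | _] = setT) //; apply/seteqP; split.
by rewrite (_ : [set _ | _] = set0) //; apply/seteqP; split.
Qed.

HB.instance Definition _ := isMeasurableFun.Build _ _ _ _ unit_path unit_path_measurable.

Definition unit_interval_measure : set (measurableTypeR R) -> \bar R :=
  mrestr (@lebesgue_measure R) (measurable_itv `[0, 1[).

HB.instance Definition _ := Measure.on unit_interval_measure.

Lemma unit_interval_measureT : unit_interval_measure setT = 1%E.
Proof.
rewrite /unit_interval_measure /mrestr setTI lebesgue_measure_itv /=.
by rewrite lte_fin ltr01 oppr0 adde0.
Qed.

HB.instance Definition _ := Measure_isProbability.Build _ _ _
  unit_interval_measure unit_interval_measureT.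

Definition path_law : probability PS R := distribution unit_interval_measure unit_path.

Lemma path_law_cylinder n (v : level G n) (p : fpath v) :
  path_law (cylinder p) = (path_mass v)%:E.
Proof.
have [l0 l1] := left_end_bounds p.
rewrite /path_law /= /distribution /pushforward /unit_interval_measure /mrestr.
rewrite (_ : _ `&` _ = `[left_end p, left_end p + path_mass v[%classic); last first.
  apply/seteqP; split=> s /=; rewrite /unit_path !in_itv /=.
    by move=> [+ s01]; rewrite s01 => /(cylinder_path_at p s01).
  move=> ps; have s01 : 0 <= s < 1 by move: ps => /andP[? ?]; apply/andP; split; lra.
  by rewrite s01; split=> //; exact/cylinder_path_at.
rewrite lebesgue_measure_itv /= lte_fin ltrDl.
case: ltP => [_|v0]; first by rewrite -EFinB addrAC subrr add0r.
by congr (_%:E); apply/esym/eqP; rewrite eq_le v0 path_mass_ge0.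
Qed.

Lemma path_law_central : central path_law.
Proof. by move=> n v p q; rewrite !path_law_cylinder. Qed.

End PathMeasure.

Section CentralMeasures.
Variables (R : realType) (G : graded_graph).
Local Notation PS := (path_space G).
Implicit Types mu nu : central_measure R G.

Lemma central_cylinder mu n (v : level G n) (p : fpath v) :
  mu (cylinder p) = (level_prob mu v / (dim v)%:R)%:E.
Proof.
by rewrite -(fine_cylinder mu p) fineK// fin_num_measure//; exact: cylinder_measurable.
Qed.

Lemma level_prob0 mu (v : level G 0) : level_prob mu v = 1.
Proof.
have := level_prob_sum1 mu 0; rewrite (bigD1 v)// big1 => [|w /andP[_]]; last first.
  by rewrite (level0_eq w v) eqxx.
by move=> h; rewrite -[LHS]addr0.
Qed.

(** Kolmogorov extension for the path space: the required measure is the image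
    of Lebesgue measure on [[0, 1[] under the coding of paths by nested
    intervals. *)
Lemma central_projlim_surjective (y : projlim (graph_system R G)) :
  exists mu, central_projlim mu = y.
Proof.
exists (CentralMeasure (path_law_central y)); apply: projlimP => n; apply: simplexP => v /=.
set mu := CentralMeasure _.
have [p _] : exists p : fpath v, True.
  by have := dim_gt0 v; rewrite /dim => /card_gt0P[p _]; exists p.
have : path_law y (cylinder p) = (level_prob mu v / (dim v)%:R)%:E := central_cylinder mu p.
rewrite path_law_cylinder => -[/esym]; apply: divIf.
by rewrite pnatr_eq0 -lt0n dim_gt0.
Qed.

Lemma central_projlim_eq mu nu : central_projlim mu = central_projlim nu ->
  forall A, measurable A -> mu A = nu A.
Proof.
move=> mn; apply: cylinder_measure_unique => n v p; last first.
  exact: (eq_ind_r (fun z => (z < +oo)%E) (ltry _) (central_cylinder mu p)).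
apply: (etrans (central_cylinder mu p)); apply: etrans (esym (central_cylinder nu p)).
congr (_ / _)%:E.
case: n v {p} => [|n] v; first by rewrite !level_prob0.
exact: (congr1 (fun z : projlim (graph_system R G) => z n v) mn).
Qed.

Lemma level_prob_congr mu nu : (forall A : set PS, measurable A -> mu A = nu A) ->
  central_projlim mu = central_projlim nu.
Proof.
move=> h; apply: projlimP => n; apply: simplexP => v /=.
by rewrite /level_prob h//; exact: level_measurable.
Qed.

(** Both sides are equalities of measures: they are compared on cylinders, whose
    masses are proportional to the probabilities of their end vertices. *)
Lemma central_projlim_conv mu nu1 nu2 (t : {i01 R}) :
  central_projlim mu = central_projlim nu1 <| t |> central_projlim nu2 <->
  forall A : set PS, measurable A ->
    mu A = ((t%:num)%:E * nu1 A + (1 - t%:num)%:E * nu2 A)%E.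
Proof.
have t1 : 0 <= 1 - t%:num by rewrite subr_ge0.
have conv_level n (v : level G n) : level_prob mu v =
    t%:num * level_prob nu1 v + (1 - t%:num) * level_prob nu2 v <->
  mu [set x | (x : ipath G) n = v] =
    ((t%:num)%:E * nu1 [set x | (x : ipath G) n = v] +
     (1 - t%:num)%:E * nu2 [set x | (x : ipath G) n = v])%E.
  have mv := level_measurable v.
  have E (m : central_measure R G) :
      m [set x | (x : ipath G) n = v] = (level_prob m v)%:E.
    by rewrite /level_prob fineK// fin_num_measure.
  by rewrite !E -!EFinM -EFinD; split=> [->//|[]].
split=> [E|E]; last first.
  apply: projlimP => n; apply: simplexP => v; rewrite convE /=.
  by apply/conv_level; apply: E; exact: level_measurable.
have tn : 0 <= t%:num by [].
pose m2 := measure_add (mscale (NngNum tn) nu1) (mscale (NngNum t1) nu2).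
have m2E A : m2 A = ((t%:num)%:E * nu1 A + (1 - t%:num)%:E * nu2 A)%E.
  by rewrite /m2 measure_addE.
move=> A mA; rewrite -m2E; move: A mA.
apply: cylinder_measure_unique => n v p; last first.
  exact: (eq_ind_r (fun z => (z < +oo)%E) (ltry _) (central_cylinder mu p)).
apply: (etrans (central_cylinder mu p)); apply: etrans (esym (m2E _)).
rewrite !central_cylinder -!EFinM -EFinD; congr (_%:E).
rewrite !mulrA -mulrDl; congr (_ / _).
case: n v {p} => [|n] v; first by rewrite !level_prob0 !mulr1 addrC subrK.
exact: (congr1 (fun z : projlim (graph_system R G) => z n v) E).
Qed.

End CentralMeasures.

(** * Ergodic central measures and the theorem *)

Section GraphCase.
Variables (R : realType) (G : graded_graph).
Local Notation PS := (path_space G).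
Implicit Types mu nu : central_measure R G.

(** A cotransition probability is nonzero exactly along an edge, so the image of
    a vertex determines its set of predecessors. *)
Lemma graph_vertex_injective : vertex_injective (graph_system R G).
Proof.
move=> n w w' /(congr1 (fun x : simplex R (level G n.+1) => coord x)) /= ww'.
apply: pred_inj; apply/setP => v; rewrite !inE.
have E (u : level G n.+2) : (edge v u) = (\sum_x (x == u)%:R * cotransition R v x != 0).
  rewrite (bigD1 u)//= eqxx mul1r big1 ?addr0 => [|x /negbTE ->]; last by rewrite mul0r.
  rewrite /cotransition; case: ifP; rewrite ?eqxx// => _; apply/esym.
  by rewrite mulf_neq0// ?invr_neq0// pnatr_eq0 -lt0n dim_gt0.
by rewrite !E; congr (_ != 0); exact: (congr1 (fun f => f v) ww').
Qed.

(** Splittings of a central measure into central measures are the same as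
    splittings of the corresponding point of the projective limit. *)
Lemma ergodicP mu : ergodic mu <-> extreme_point (central_projlim mu).
Proof.
split=> [erg y z t t01 xE|ext nu1 nu2 t t01 muE A mA].
  have [nu1 n1] := central_projlim_surjective y.
  have [nu2 n2] := central_projlim_surjective z.
  subst y z; have := erg nu1 nu2 _ t01 ((central_projlim_conv _ _ _ _).1 xE) => h.
  by split; apply: level_prob_congr => A mA; have [] := h A mA.
have [t0 t1] := andP t01.
pose t' := Itv01 (ltW t0) (ltW t1).
have t'01 : 0 < t'%:num < 1 by [].
have [h1 h2] := ext _ _ t' t'01 ((central_projlim_conv mu nu1 nu2 t').2 muE).
by split; apply: central_projlim_eq.
Qed.

Lemma central_projlim_continuous : continuous (@central_projlim R G).
Proof. exact: initial_continuous. Qed.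

End GraphCase.

Theorem theorem2 (R : realType) :
  (forall (S : proj_system R) (k : nat) (rho : vert S k -> vert S k -> R),
    vertex_injective S -> is_metric rho ->
    (uniformly_compact rho (fun i => [set: simplex R (vert S (i + k))]) <->
     uniformly_compact rho (fun i => range (@vertex R (vert S (i + k))))) /\
    (uniformly_compact rho (fun i => [set: simplex R (vert S (i + k))]) ->
     [/\ forall x : projlim S, extreme_point x -> standard_point rho x,
         closed [set x : projlim S | extreme_point x],
         forall U : set (projlim S), open U <-> metric_open (limit_metric rho) U
       & [set x : projlim S | extreme_point x] =
         [set x | exists v, regular_limit rho v x]]))
  /\
  (forall (G : graded_graph) (k : nat)
      (rho : vert (graph_system R G) k -> vert (graph_system R G) k -> R),
    is_metric rho ->
    uniformly_compact rho
      (fun i => range (@vertex R (vert (graph_system R G) (i + k)))) ->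
    [/\ forall mu : central_measure R G,
          ergodic mu -> standard_point rho (central_projlim mu),
        closed [set mu : central_measure R G | ergodic mu],
        forall U : set (central_measure R G), open U <->
          metric_open (fun mu nu =>
            limit_metric rho (central_projlim mu) (central_projlim nu)) U
      & [set mu : central_measure R G | ergodic mu] =
        [set mu | exists v, regular_limit rho v (central_projlim mu)]]).
Proof.
split=> [S k rho Sinj rhoM|G k rho rhoM ucv].
  split; last exact: projlim_standard.
  by split; [exact: uniformly_compact_vertices|exact: uniformly_compact_simplices].
have Sinj := @graph_vertex_injective R G.
have uc := uniformly_compact_simplices Sinj rhoM ucv.
have [std clo top reg] := projlim_standard Sinj rhoM uc.
have ergE : [set mu : central_measure R G | ergodic mu] =
    @central_projlim R G @^-1` [set x | extreme_point x].
  by apply/seteqP; split=> mu /= /ergodicP.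
split.
- by move=> mu /ergodicP; exact: std.
- rewrite ergE; apply: closed_comp clo => mu _; exact: central_projlim_continuous.
- move=> U; split=> [[V oV <-] mu Vmu|mU].
    by have [e e0 Ve] := (top V).1 oV _ Vmu; exists e => // nu /Ve.
  rewrite openE => mu /mU[e e0 eU].
  apply: filterS eU _.
  apply: (@central_projlim_continuous R G mu
    [set x | limit_metric rho (central_projlim mu) x < e]).
  exact: nbhs_limit_ball.
- by rewrite ergE reg.
Qed.
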